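(* Let $\eta>0$ and let $f,g:\mathbb{R}^d\to\mathbb{R}$ be convex functions such that $\pi^{XY}(x,y)\propto\exp(-f(x)-g(y)-\frac{1}{2\eta}\|x-y\|_2^2)$ is a normalizable density with finite second moments. Consider the Gibbs sampler: draw $x^0\sim\mu_0^X$ (with finite second moment); for $k=0,1,2,\dots$, draw $y^k\sim\pi^{Y|X=x^k}\propto\exp(-g(y)-\frac{1}{2\eta}\|x^k-y\|_2^2)$ and then $x^{k+1}\sim\pi^{X|Y=y^k}\propto\exp(-f(x)-\frac{1}{2\eta}\|x-y^k\|_2^2)$. Let $\mu_k^{XY}$ be the law of $(x^k,y^k)$. Then for every $k\ge1$, $$D_{\mathrm{KL}}(\mu_k^{XY}\|\pi^{XY})\le\frac{W_2^2(\mu_0^X,\pi^X)}{k\eta}.$$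
   Context: $\pi^X$ is the $X$-marginal of $\pi^{XY}$. $D_{\mathrm{KL}}(\mu\|\nu)=\int\mu\log\frac{\mu}{\nu}$. The 2-Wasserstein distance is $W_2^2(\mu,\nu)=\inf_{\gamma\in\Gamma(\mu,\nu)}\int\|x-y\|_2^2\,\mathrm{d}\gamma(x,y)$, where $\Gamma(\mu,\nu)$ is the set of couplings of $\mu$ and $\nu$. *)

(* Defs.v *)
From HB Require Import structures.
From mathcomp Require Import all_boot all_order all_algebra.
From mathcomp Require Import all_classical all_reals all_analysis.
Set Implicit Arguments. Unset Strict Implicit. Unset Printing Implicit Defensive.
Import Order.TTheory GRing.Theory Num.Theory.
Local Open Scope classical_set_scope.
Local Open Scope ring_scope.

(* R^d is represented by d.-tuple R, with the product (Borel) sigma-algebra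
   provided by MathComp-Analysis (measure_tuple_display). *)

Section Defs.
Variable R : realType.

Definition dist2 (d : nat) (x y : d.-tuple R) : R :=
  \sum_(i < d) (tnth x i - tnth y i) ^+ 2.

Definition sqnorm (d : nat) (x : d.-tuple R) : R :=
  \sum_(i < d) (tnth x i) ^+ 2.

Definition tcomb (d : nat) (t : R) (x y : d.-tuple R) : d.-tuple R :=
  [tuple t * tnth x i + (1 - t) * tnth y i | i < d].

Definition convex_fun (d : nat) (f : d.-tuple R -> R) : Prop :=
  forall (x y : d.-tuple R) (t : R), 0 <= t -> t <= 1 ->
    f (tcomb t x y) <= t * f x + (1 - t) * f y.

(* Lebesgue integral over R^d of a function with values in \bar R,
   defined as the iterated integral w.r.t. the one-dimensional Lebesgue
   measure (for nonnegative measurable functions this is the integral w.r.t.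
   the d-dimensional Lebesgue measure, by Tonelli). *)
Fixpoint lebRd_int (d : nat) : (d.-tuple R -> \bar R) -> \bar R :=
  match d return (d.-tuple R -> \bar R) -> \bar R with
  | 0 => fun F => F [tuple]
  | n.+1 => fun F =>
      (\int[@lebesgue_measure R]_x lebRd_int (fun t : n.-tuple R => F [tuple of x :: t]))%E
  end.

(* Kullback--Leibler divergence D_KL(mu || nu) = \int mu log (mu / nu):
   if mu has a density h = dmu/dnu, this is \int h ln h dnu (with 0 ln 0 = 0,
   as ln 0 = 0 in MathComp-Analysis); it is +oo if mu has no density w.r.t. nu.
   All densities agree nu-a.e., so the infimum below is that common value,
   and it is +oo (infimum of the empty set) when no density exists. *)
Definition is_density d (T : measurableType d) (mu nu : set T -> \bar R)
  (h : T -> R) : Prop :=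
  [/\ measurable_fun setT h, (forall x, 0 <= h x) &
      forall A, measurable A -> mu A = (\int[nu]_(x in A) (h x)%:E)%E].

Definition KL d (T : measurableType d) (mu nu : probability T R) : \bar R :=
  ereal_inf [set (\int[nu]_x (h x * ln (h x))%:E)%E | h in is_density mu nu].

Definition is_coupling (n : nat) (mu nu : set (n.-tuple R) -> \bar R)
  (gam : probability (n.-tuple R * n.-tuple R)%type R) : Prop :=
  forall A : set (n.-tuple R), measurable A ->
    gam (A `*` setT) = mu A /\ gam (setT `*` A) = nu A.

Definition W2sq (n : nat) (mu nu : set (n.-tuple R) -> \bar R) : \bar R :=
  ereal_inf [set (\int[gam]_p (dist2 p.1 p.2)%:E)%E | gam in is_coupling mu nu].

Definition marginalX (n : nat) (P : set (n.-tuple R * n.-tuple R)%type -> \bar R)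
  : set (n.-tuple R) -> \bar R := fun A => P (A `*` setT).

Definition joint_dens (n : nat) (f g : n.-tuple R -> R) (eta : R)
  (x y : n.-tuple R) : R :=
  expR (- f x - g y - dist2 x y / (2 * eta)).

(* Integral of phi against the probability with density proportional to
   z |-> exp(-h z - |z - c|^2/(2 eta)) : this is the Gibbs conditional
   pi^{Y|X=c} (h = g) or pi^{X|Y=c} (h = f). *)
Definition cond_int (n : nat) (h : n.-tuple R -> R) (eta : R) (c : n.-tuple R)
  (phi : n.-tuple R -> \bar R) : \bar R :=
  (lebRd_int (fun z => phi z * (expR (- h z - dist2 c z / (2 * eta)))%:E) *
   (fine (lebRd_int (fun z => (expR (- h z - dist2 c z / (2 * eta)))%:E)))^-1%:E)%E.

End Defs.

(* Main.v *)
Require Import Defs.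
From HB Require Import structures.
From mathcomp Require Import all_boot all_order all_algebra.
From mathcomp Require Import all_classical all_reals all_analysis.
From mathcomp Require Import measurable_realfun.
From mathcomp Require Import ring lra.
Set Implicit Arguments. Unset Strict Implicit. Unset Printing Implicit Defensive.
Import Order.TTheory GRing.Theory Num.Theory.
Local Open Scope classical_set_scope.
Local Open Scope ring_scope.

(** Let Q_x be the law with density proportional to exp(- h z - |x - z|^2 / (2 eta))
    and Z(x) its normalising constant. The Prékopa-Leindler inequality enters twice.
    First, ln Z is concave, whence the log-Harnack inequality
      Q_x v <= ln (Q_y e^v) + |x - y|^2 / (2 eta).
    Second, if F(z) <= ln phi(z') + |z - z'|^2 / (2 eta n) for all z, z', then with
    t = 1 / (n + 1) it gives t ln (Q_y e^(F / t)) <= ln (Q_y phi); together with the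
    first inequality applied to v = F / t this yields
      Q_x F <= ln (Q_y phi) + |x - y|^2 / (2 eta (n + 1)).
    Iterating over the 2 k half-steps of k Gibbs steps P,
      P^k u (x) <= ln (P^k e^u (y)) + |x - y|^2 / (4 eta k).
    Integrating over a coupling of mu_0 and pi^X, Jensen's inequality and the invariance
    of pi bound the integral of u against the law of x^k by ln (\int e^u dpi^X) plus
    the transport cost; u = ln (d mu_k / d pi), suitably truncated, gives the entropy
    bound, since the density of mu_k with respect to pi depends on x only. *)

(** * Convex functions on R^d *)

Section Convex.
Variable R : realType.

(** Entropy appears only at the very end; until then everything is dual, about integrals of bounded
    test functions, so no finiteness of entropies has to be carried along. The value t = 1 / (n + 1)
    is forced. In the second Prékopa-Leindler step the points z and w meet at t z + (1 - t) w: the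
    previous cost charges (1 - t)^2 |z - w|^2 / (2 eta n), while the quadratic term of the exponent
    gives back t (1 - t) |z - w|^2 / (2 eta), and the two balance exactly for this t. The rate 1 /
    (4 eta k) so obtained is four times better than the one claimed. Logarithms are real-valued, so
    their arguments must stay positive: test functions are kept in [0, B] and their exponentials in
    [1, e^B], two ranges that both kernels preserve. This is why the truncated log-density is
    shifted by ln N before it is used as a test function; the shift cancels because the density has
    mass one. Derivatives of ln Z are replaced by difference quotients with an explicit error, so
    nothing is differentiated under an integral. *)

Lemma tcombE d t (x y : d.-tuple R) i :
  tnth (tcomb t x y) i = t * tnth x i + (1 - t) * tnth y i.
Proof. by rewrite tnth_mktuple. Qed.

Lemma tcomb_cons d t a b (x y : d.-tuple R) :
  tcomb t [tuple of a :: x] [tuple of b :: y] =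
  [tuple of t * a + (1 - t) * b :: tcomb t x y].
Proof.
apply: eq_from_tnth => i; rewrite tcombE.
by case: (unliftP ord0 i) => [j|] ->; rewrite ?tnthS ?tnth0 ?tcombE.
Qed.

Lemma tcombxx d t (x : d.-tuple R) : tcomb t x x = x.
Proof. by apply: eq_from_tnth => i; rewrite tcombE; ring. Qed.

Lemma convex_fun_cons d (g : d.+1.-tuple R -> R) a :
  convex_fun g -> convex_fun (fun t : d.-tuple R => g [tuple of a :: t]).
Proof.
move=> cg x y t t0 t1; have := cg [tuple of a :: x] [tuple of a :: y] t t0 t1.
by rewrite tcomb_cons (_ : t * a + (1 - t) * a = a)//; ring.
Qed.

(** Induction on [d]: a point of the box lies on a segment, parallel to the first axis, between two
    opposite faces, and on each face the induction hypothesis gives a bound. *)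
Lemma convex_bounded_box d (g : d.-tuple R -> R) (c : d.-tuple R) :
  convex_fun g ->
  exists M, forall y : d.-tuple R,
    (forall i, `|tnth y i - tnth c i| <= 1) -> g y <= M.
Proof.
elim: d g c => [|d IH] g c cg.
  by exists (g [tuple]) => y _; rewrite (tuple0 y).
have [M1 h1] := IH _ [tuple of behead c] (convex_fun_cons (thead c + 1) cg).
have [M2 h2] := IH _ [tuple of behead c] (convex_fun_cons (thead c - 1) cg).
exists (Num.max M1 M2) => y yc.
pose s := (thead y - thead c + 1) / 2.
have yc0 : `|thead y - thead c| <= 1 by exact: yc.
move: yc0; rewrite ler_norml => /andP[yc0 yc1].
have s0 : 0 <= s by rewrite /s; lra.
have s1 : s <= 1 by rewrite /s; lra.
pose t := [tuple of behead y].
have bt i : `|tnth t i - tnth [tuple of behead c] i| <= 1.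
  have := yc (lift ord0 i).
  by rewrite {1}(tuple_eta y) {1}(tuple_eta c) !tnthS.
have -> : y = tcomb s [tuple of thead c + 1 :: t] [tuple of thead c - 1 :: t].
  rewrite tcomb_cons tcombxx [LHS]tuple_eta; apply/val_inj => /=; congr cons.
  by rewrite /s; field.
apply: (le_trans (cg _ _ _ s0 s1)).
have a1 : g [tuple of thead c + 1 :: t] <= Num.max M1 M2.
  by rewrite le_max h1.
have a2 : g [tuple of thead c - 1 :: t] <= Num.max M1 M2.
  by rewrite le_max h2 ?orbT.
rewrite [leRHS](_ : _ = s * Num.max M1 M2 + (1 - s) * Num.max M1 M2); last ring.
by rewrite lerD// ler_wpM2l// subr_ge0.
Qed.

(** The point [w] = - y / (1 + s) is in the unit box, where g is bounded above, and the origin is l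
    y + (1 - l) w; convexity at the origin then bounds g y from below. This growth bound makes exp
    (- g) integrable against a Gaussian. *)
Lemma convex_ge_affine d (g : d.-tuple R -> R) : convex_fun g ->
  exists K, forall y, g y >= - K * (1 + \sum_(i < d) `|tnth y i|).
Proof.
move=> cg; pose o : d.-tuple R := [tuple 0 | i < d].
have [M hM] := convex_bounded_box o cg.
exists (`|M| + 2 * `|g o|) => y.
set s := \sum_(i < d) _.
have s0 : 0 <= s by exact: sumr_ge0.
pose w : d.-tuple R := [tuple - tnth y i / (1 + s) | i < d].
have hw : g w <= M.
  apply: hM => i; rewrite !tnth_mktuple subr0 normrM normrN normfV.
  rewrite [`|1 + s|]ger0_norm; last lra.
  rewrite ler_pdivrMr; last lra.
  rewrite mul1r /s (bigD1 i)//= addrCA lerDl.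
  by rewrite addr_ge0// sumr_ge0.
pose l := (2 + s)^-1.
have l0 : 0 < l by rewrite invr_gt0; lra.
have l1 : l <= 1 by rewrite invf_le1; lra.
have := cg y w l (ltW l0) l1.
have -> : tcomb l y w = o.
  apply: eq_from_tnth => i; rewrite tcombE !tnth_mktuple /l.
  by field; rewrite !gt_eqF//; lra.
have -> : 1 - l = (1 + s) * l.
  by rewrite /l; field; rewrite gt_eqF//; lra.
rewrite -[X in _ <= _ + X]mulrA [(1 + s) * (l * _)]mulrCA -mulrDr mulrC -ler_pdivrMr// invrK => h.
have hM' : (1 + s) * g w <= (1 + s) * `|M|.
  by rewrite ler_wpM2l//; [lra|rewrite (le_trans hw)// ler_norm].
have ho : - `|g o| <= g o by rewrite lerNnormlW.
have n0 : 0 <= `|g o| by [].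
nra.
Qed.

(** The extrapolations [u] and [v] of z - c by 1 / e, in both directions, stay in the unit box
    around c. Since z lies between c and [u], g z is bounded above; since c lies between z and [v],
    it is bounded below. *)
Lemma convex_modulus d (g : d.-tuple R -> R) (c : d.-tuple R) : convex_fun g ->
  exists M, forall (e : R) (z : d.-tuple R), 0 < e -> e <= 1 ->
    (forall i, `|tnth z i - tnth c i| <= e) -> `|g z - g c| <= e * M.
Proof.
move=> cg; have [M hM] := convex_bounded_box c cg.
exists (M - g c) => e z e0 e1 zc.
have eD i : `|(tnth z i - tnth c i) / e| <= 1.
  by rewrite normrM normfV (gtr0_norm e0) ler_pdivrMr// mul1r.
pose u : d.-tuple R := [tuple tnth c i + (tnth z i - tnth c i) / e | i < d].
pose v : d.-tuple R := [tuple tnth c i - (tnth z i - tnth c i) / e | i < d].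
have hu : g u <= M by apply: hM => i; rewrite tnth_mktuple addrAC subrr add0r.
have hv : g v <= M.
  by apply: hM => i; rewrite tnth_mktuple addrAC subrr add0r normrN.
have := cg u c e (ltW e0) e1.
have -> : tcomb e u c = z.
  by apply: eq_from_tnth => i; rewrite tcombE tnth_mktuple; field; rewrite gt_eqF.
pose l := (1 + e)^-1.
have l0 : 0 < l by rewrite invr_gt0; lra.
have l1 : l <= 1 by rewrite invf_le1; lra.
have := cg z v l (ltW l0) l1.
have -> : tcomb l z v = c.
  apply: eq_from_tnth => i; rewrite tcombE tnth_mktuple /l; field.
  by rewrite !gt_eqF//; lra.
have -> : 1 - l = e * l by rewrite /l; field; rewrite gt_eqF//; lra.
move=> h1 h2; move: h1.
rewrite -[X in _ <= _ + X]mulrA [e * (l * _)]mulrCA -mulrDr mulrC -ler_pdivrMr// invrK => h1.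
have := ler_wpM2l (ltW e0) hu; have := ler_wpM2l (ltW e0) hv.
rewrite ler_norml; nra.
Qed.

Definition grid d (n : nat) (q : d.-tuple int) : d.-tuple R :=
  [tuple (tnth q i)%:~R / n.+1%:R | i < d].

Definition cell d (n : nat) (y : d.-tuple R) : d.-tuple int :=
  [tuple Num.floor (tnth y i * n.+1%:R) | i < d].

Lemma measurable_cell_fiber d n (q : d.-tuple int) :
  measurable [set y : d.-tuple R | cell n y = q].
Proof.
have -> : [set y : d.-tuple R | cell n y = q] =
    \bigcap_(i : 'I_d) [set y | Num.floor (tnth y i * n.+1%:R) = tnth q i].
  apply/seteqP; split => y /=.
    by move=> <- i _ /=; rewrite tnth_mktuple.
  by move=> h; apply: eq_from_tnth => i; rewrite tnth_mktuple; exact: h.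
apply: fin_bigcap_measurable => //.
move=> i _.
have mf : measurable_fun setT (fun y : d.-tuple R => tnth y i * n.+1%:R).
  by apply: measurable_funM => //; exact: measurable_tnth.
have := mf measurableT `[(tnth q i)%:~R, (tnth q i)%:~R + 1[%classic.
rewrite setTI => /(_ (measurable_itv _)).
congr (measurable _); apply/seteqP; split => y /=; rewrite in_itv/=.
  move=> /andP[h1 h2]; apply: floor_def.
  by rewrite intrD h1.
by move=> <-; rewrite floor_le//= -intrD1 floorD1_gt.
Qed.

(** Rounding down to the lattice of mesh 1 / (n + 1) gives functions with countably many values on
    measurable cells; by [convex_modulus] they converge to g pointwise. *)
Lemma convex_measurable d (g : d.-tuple R -> R) : convex_fun g ->
  measurable_fun setT g.
Proof.
move=> cg.
apply: (@measurable_fun_cvg _ _ _ _ (fun n y => g (grid n (cell n y)))) => //.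
  move=> n _ B mB; rewrite setTI.
  have -> : (fun y => g (grid n (cell n y))) @^-1` B =
      \bigcup_q ([set y : d.-tuple R | cell n y = q] `&`
                 [set _ | B (g (grid n q))]).
    apply/seteqP; split => y /=; first by move=> By; exists (cell n y).
    by move=> [q _ [<-]].
  apply: countable_bigcupT_measurable; first exact: countableP.
  move=> q; apply: measurableI; first exact: measurable_cell_fiber.
  have [Bq|Bq] := pselect (B (g (grid n q))).
    by rewrite (_ : mkset _ = setT)//; apply/seteqP; split.
  by rewrite (_ : mkset _ = set0)//; apply/seteqP; split.
move=> y _; have [M hM] := convex_modulus y cg.
have gy n : `|g (grid n (cell n y)) - g y| <= n.+1%:R^-1 * M.
  apply: hM; rewrite ?invr_gt0 ?invf_le1 ?ler1n// => i.
  rewrite !tnth_mktuple.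
  set z := tnth y i; set N : R := n.+1%:R.
  have N0 : 0 < N by rewrite ltr0n.
  rewrite (_ : _ / _ - _ = ((Num.floor (z * N))%:~R - z * N) / N); last first.
    by field; rewrite gt_eqF.
  rewrite normrM normfV (gtr0_norm N0) ler_pdivrMr// mulVf ?gt_eqF//.
  rewrite distrC ger0_norm ?subr_ge0 ?floor_le//.
  by rewrite lerBlDl -intrD1 ltW// floorD1_gt.
apply/cvgrPdist_le => e e0.
near=> n; rewrite distrC (le_trans (gy n))//.
rewrite mulrC ler_pdivrMr//.
rewrite -ler_pdivrMl//.
near: n.
exists (Num.truncn (e^-1 * M)) => // n /= hn.
rewrite ltW//.
by rewrite (lt_le_trans (truncnS_gt _))// ler_nat.
Unshelve. all: by end_near.
Qed.

End Convex.

(** * Lebesgue measure on R^d *)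

Section TupleLebesgue.
Variable R : realType.
Local Open Scope ereal_scope.

Definition tcons n (p : measurableTypeR R * n.-tuple R) : n.+1.-tuple R :=
  [tuple of p.1 :: p.2].

Lemma measurable_tcons n : measurable_fun setT (@tcons n).
Proof.
apply: (@measurable_cons _ _ _ R (fun p => p.1 : R)) => //.
exact: measurable_fst.
Qed.

Section succ.
Variables (n : nat) (m : {sigma_finite_measure set (n.-tuple R) -> \bar R}).

Definition msucc : set (n.+1.-tuple R) -> \bar R :=
  pushforward (@lebesgue_measure R \x m) (@tcons n).

HB.instance Definition _ := Measure.copy msucc
  (measure_function_pushforward__canonical__measure_function_Measure
     (@lebesgue_measure R \x m) (@measurable_tcons n)).

(** Carried along the recursion because Tonelli is applied in every dimension; the exhausting sets
    are rectangles F_i x G_i read through [split]. *)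
Lemma msucc_sigma_finite : sigma_finite setT msucc.
Proof.
have /sigma_finiteP[F [FT ndF Foo]] :=
  sigma_finiteT (@lebesgue_measure R : {sigma_finite_measure set _ -> \bar R}).
have /sigma_finiteP[G [GT ndG Goo]] := sigma_finiteT m.
pose split (t : n.+1.-tuple R) : measurableTypeR R * n.-tuple R :=
  (thead t, [tuple of behead t]).
exists (fun i => split @^-1` (F i `*` G i)).
  apply/seteqP; split => // t _.
  have [i _ Fi] : (\bigcup_i F i) (split t).1 by rewrite -FT.
  have [j _ Gj] : (\bigcup_i G i) (split t).2 by rewrite -GT.
  exists (maxn i j) => //; split.
  - by move: Fi; exact/subsetPset/ndF/leq_maxl.
  - by move: Gj; exact/subsetPset/ndG/leq_maxr.
move=> i; have [mF Fi] := Foo i; have [mG Gi] := Goo i; split.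
  rewrite -[X in measurable X]setTI.
  apply: (@measurable_fun_pair _ _ _ _ (measurableTypeR R)
    (n.-tuple R) (fun t => thead t) (fun t => [tuple of behead t])) => //.
  - exact: measurable_tnth.
  - exact: measurable_behead.
  - exact: measurableX.
rewrite /msucc /pushforward (_ : _ @^-1` _ = F i `*` G i)//.
  by rewrite product_measure1E// lte_mul_pinfty// ge0_fin_numE.
have splitK p : split (tcons p) = p.
  by case: p => x t; rewrite /split /tcons /= theadE; congr pair; exact/val_inj.
by apply/seteqP; split=> p; rewrite /preimage /mkset splitK.
Qed.

HB.instance Definition _ := @Measure_isSigmaFinite.Build _ _ _ msucc msucc_sigma_finite.

End succ.

(** A genuine measure behind the iterated integral [lebRd_int], which makes linearity, monotone
    convergence and Tonelli available. Lebesgue measure on R^0 is the Dirac mass at its only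
    point. *)
Fixpoint lebRd (n : nat) : {sigma_finite_measure set (n.-tuple R) -> \bar R} :=
  match n return {sigma_finite_measure set (n.-tuple R) -> \bar R} with
  | 0 => \d_[tuple]
  | p.+1 => msucc (lebRd p)
  end.

Lemma integral_lebRdS n (F : n.+1.-tuple R -> \bar R) :
  measurable_fun setT F -> (forall t, 0 <= F t) ->
  \int[lebRd n.+1]_t F t =
  \int[@lebesgue_measure R]_x \int[lebRd n]_t F [tuple of x :: t].
Proof.
move=> mF F0 /=.
rewrite (@ge0_integral_pushforward _ _ _ _ R _ (@measurable_tcons n))//=.
rewrite preimage_setT.
rewrite fubini_tonelli1//=.
by apply: measurableT_comp => //; exact: measurable_tcons.
Qed.

Lemma lebRd_intE n (F : n.-tuple R -> \bar R) :
  measurable_fun setT F -> (forall t, 0 <= F t) ->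
  lebRd_int F = \int[lebRd n]_t F t.
Proof.
elim: n F => [|n IH] F mF F0.
  by rewrite /= integral_dirac// diracT mul1e.
rewrite integral_lebRdS//=; apply: eq_integral => x _.
apply: IH => //.
apply: measurableT_comp => //.
exact: measurable_cons.
Qed.

Lemma measurable_lebRd_int_cons n (F : n.+1.-tuple R -> \bar R) :
  measurable_fun setT F -> (forall t, 0 <= F t) ->
  measurable_fun setT
    (fun x : measurableTypeR R => \int[lebRd n]_t F [tuple of x :: t]).
Proof.
move=> mF F0.
apply: (@measurable_fun_fubini_tonelli_F _ _ (measurableTypeR R) _ R (lebRd n)
  (F \o @tcons n)) => //.
  by apply: measurableT_comp => //; exact: measurable_tcons.
by move=> x; exact: F0.
Qed.

End TupleLebesgue.

(** * The Prékopa-Leindler inequality *)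

Section PrekopaLeindler.
Variable R : realType.
Local Notation mR := (measurableTypeR R).
Local Notation leb := (@lebesgue_measure R).

(** Weighted sum of the tangent inequalities at the mean [w]. It serves as the arithmetic-geometric
    mean inequality that turns the additive one-dimensional bound into the multiplicative one. *)
Lemma expR_convex (l u v : R) : 0 <= l -> l <= 1 ->
  expR (l * u + (1 - l) * v) <= l * expR u + (1 - l) * expR v.
Proof.
move=> l0 l1; set w := l * u + _.
have tangent z : expR w * (1 + (z - w)) <= expR z.
  have -> : expR z = expR w * expR (z - w) by rewrite -expRD; congr expR; ring.
  by rewrite ler_wpM2l ?expR_ge0 ?expR_ge1Dx.
rewrite [leLHS](_ : _ = l * (expR w * (1 + (u - w))) +
  (1 - l) * (expR w * (1 + (v - w)))); last by rewrite /w; ring.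
by rewrite lerD// ler_wpM2l// subr_ge0.
Qed.

Section affine.
Variables (a b : R).
Hypothesis a0 : 0 < a.

Let phi (x : mR) : mR := a * x + b.

Lemma measurable_affine : measurable_fun setT phi.
Proof. by apply: measurable_funD => //; exact: measurable_funM. Qed.

Let scaled : {measure set mR -> \bar R} := mscale (NngNum (ltW a0))
  (measure_function_pushforward__canonical__measure_function_Measure leb
     measurable_affine).

(** Uniqueness of Lebesgue measure: the rescaled pushforward has the right value on half-open
    intervals. *)
Lemma lebesgue_measure_affine (A : set mR) : measurable A ->
  leb A = (a%:E * leb [set x | A (a * x + b)%R])%E.
Proof.
move=> mA; rewrite (@lebesgue_measure_unique _ scaled _ A)// => X [[u v] uv <-].
rewrite /scaled /= /mscale /= /pushforward lebesgue_measure_itv/=.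
have -> : phi @^-1` `]u, v]%classic = `](u - b) / a, (v - b) / a]%classic.
  apply/seteqP; split => x; rewrite /phi /= !in_itv/= ltr_pdivrMr// ler_pdivlMr//.
    by move=> /andP[? ?]; apply/andP; split; lra.
  by move=> /andP[? ?]; apply/andP; split; lra.
rewrite lebesgue_measure_itv/= !lte_fin ltr_pM2r ?invr_gt0// ltrD2r.
case: ifPn => _; last by rewrite mule0.
by rewrite -!EFinB -EFinM; congr EFin; field; rewrite gt_eqF.
Qed.

End affine.

Lemma le_scaled_lebesgue (l c : R) (A C : set mR) : 0 < l ->
  measurable A -> measurable C -> (forall x, A x -> C (l * x + c)) ->
  (l%:E * leb A <= leb C)%E.
Proof.
move=> l0 mA mC AC; rewrite (lebesgue_measure_affine c l0 mC).
apply: lee_wpmul2l; first by rewrite lee_fin ltW.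
apply: le_measure; rewrite ?inE//.
by rewrite -[X in measurable X]setTI; exact: measurable_affine.
Qed.

(* The copies l A + (1 - l) b0 and l a0 + (1 - l) B of A and B inside C
   essentially meet in one point when a0 is near sup A and b0 near inf B. *)
Lemma brunn_minkowski1 (l N : R) (A B C : set mR) : 0 < l -> l < 1 ->
  measurable A -> measurable B -> measurable C -> A !=set0 -> B !=set0 ->
  (forall x, A x -> `|x| <= N) -> (forall x, B x -> `|x| <= N) ->
  (forall x y, A x -> B y -> C (l * x + (1 - l) * y)) ->
  (l%:E * leb A + (1 - l)%:E * leb B <= leb C)%E.
Proof.
move=> l0 l1 mA mB mC A0 B0 AN BN ABC.
have hA : has_sup A.
  by split=> //; exists N => x /AN; rewrite ler_norml => /andP[].
have hB : has_inf B.
  by split=> //; exists (- N) => x /BN; rewrite ler_norml => /andP[].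
apply/lee_addgt0Pr => e e0.
have [a0 Aa0 a0e] := sup_adherent e0 hA.
have [b0 Bb0 b0e] := inf_adherent e0 hB.
pose p := l * sup A + (1 - l) * b0.
pose q := l * a0 + (1 - l) * inf B.
have pq : p - q <= e by rewrite /p /q; nra.
have l1' : 0 < 1 - l by rewrite subr_gt0.
have h1 : (l%:E * leb A <= leb (C `&` `]-oo, p]))%E.
  apply: (@le_scaled_lebesgue _ ((1 - l) * b0)) => //; first exact: measurableI.
  move=> x Ax; split; first exact: ABC.
  by rewrite /= in_itv/= lerD2r ler_pM2l//; apply: sup_upper_bound.
have h2 : ((1 - l)%:E * leb B <= leb (C `&` `[q, +oo[))%E.
  apply: (@le_scaled_lebesgue _ (l * a0)) => //; first exact: measurableI.
  move=> x Bx; rewrite addrC; split; first exact: ABC.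
  by rewrite /= in_itv/= andbT lerD2l ler_pM2l//; apply: (ge_inf hB.2).
apply: (le_trans (leeD h1 h2)).
(* Cutting the first copy at [q] instead of [p] makes the two copies disjoint and costs at most the
   length p - q <= e. *)
have h3 : (leb (C `&` `]-oo, p]) <= leb (C `&` `]-oo, q[) + e%:E)%E.
  apply: (@le_trans _ _ (leb ((C `&` `]-oo, q[) `|` `[q, p]))).
    apply: le_measure; rewrite ?inE//; first exact: measurableI.
      by apply: measurableU => //; exact: measurableI.
    move=> x [Cx]; rewrite /= !in_itv/= => xp.
    by have [qx|xq] := leP q x; [right; apply/andP|left].
  apply: (le_trans (measureU2 _ _ _)) => //; first exact: measurableI.
  apply: leeD2l.
  have : (leb `[q, p]%classic <= e%:E)%E.
    rewrite lebesgue_measure_itv/= lte_fin; case: ifPn => _.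
      by rewrite -EFinB lee_fin.
    by rewrite lee_fin ltW.
  exact.
rewrite addeC (le_trans (leeD2l _ h3))// addeA leeD2r//.
rewrite -measureU//; [|exact: measurableI|exact: measurableI|].
  apply: le_measure; rewrite ?inE//; last by move=> x [[]|[]].
  by apply: measurableU; exact: measurableI.
apply/seteqP; split => // x [[_ /=]]; rewrite in_itv/= andbT => qx [_ /=].
by rewrite in_itv/= => /(le_lt_trans qx); rewrite ltxx.
Qed.

Lemma measurable_setE d (T : measurableType d) (b : T -> bool) :
  measurable_fun setT b -> measurable [set x | b x].
Proof.
move=> mb; have := mb measurableT [set true]; rewrite setTI => /(_ _).
by apply.
Qed.

(** Both suprema are 1, so at every level r in ]0, 1[ the superlevel sets of f and g are nonempty
    and [brunn_minkowski1] applies to them; integrating over r gives the arithmetic mean of the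
    integrals. With different suprema some levels would have one empty set and the argument would
    break down. *)
Lemma prekopa_leindler_normalized (l N : R) (f g : mR -> R) (h : mR -> \bar R) :
  0 < l -> l < 1 ->
  measurable_fun setT f -> measurable_fun setT g -> measurable_fun setT h ->
  (forall x, 0 <= f x <= 1) -> (forall x, 0 <= g x <= 1) ->
  (forall x, 0 <= h x)%E ->
  (forall x, N < `|x| -> f x = 0) -> (forall x, N < `|x| -> g x = 0) ->
  (forall r, r < 1 -> exists x, r < f x) ->
  (forall r, r < 1 -> exists x, r < g x) ->
  (forall x y r, 0 < r -> r < f x -> r < g y ->
    (r%:E <= h (l * x + (1 - l) * y)%R)%E) ->
  (l%:E * (\int[leb]_x (f x)%:E) + (1 - l)%:E * (\int[leb]_x (g x)%:E)
    <= \int[leb]_x h x)%E.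
Proof.
move=> l0 l1 mf mg mh f01 g01 h0 fN gN f1 g1 fgh.
pose Ef (f : mR -> R) : set (mR * mR) :=
  [set p | (0 < p.2) && (p.2 < 1) && (p.2 < f p.1)].
pose Eh : set (mR * mR) :=
  [set p | (0 < p.2) && (p.2 < 1) && (p.2%:E <= h p.1)%E].
have msnd : measurable_fun [set: mR * mR] (fun p => p.2 : R).
  exact: measurable_snd.
have mfst : measurable_fun [set: mR * mR] (fun p => p.1 : mR).
  exact: measurable_fst.
have m01 : measurable_fun [set: mR * mR]
    (fun p => ((0 : R) < p.2) && ((p.2 : R) < 1)).
  by apply: measurable_and; apply: measurable_fun_ltr.
have mEf k : measurable_fun setT k -> measurable (Ef k).
  move=> mk; apply: measurable_setE; apply: measurable_and => //.
  by apply: measurable_fun_ltr => //; exact: measurableT_comp.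
have mEh : measurable Eh.
  apply: measurable_setE; apply: measurable_and => //.
  apply: measurable_fun_lee; first exact: measurableT_comp.
  exact: measurableT_comp.
have indic (E : set (mR * mR)) : measurable E ->
    measurable_fun setT (fun p => (\1_E p : R)%:E).
  by move=> mE; exact/measurable_EFinP/measurable_indic.
have layer (k : mR -> R) : measurable_fun setT k -> (forall x, 0 <= k x <= 1) ->
    (\int[leb]_x (k x)%:E =
     \int[leb]_r \int[leb]_x (\1_(Ef k) (x, r))%:E)%E.
  move=> mk k01.
  rewrite -(fubini_tonelli (fun p => (\1_(Ef k) p)%:E))//; last exact: indic (mEf _ mk).
  apply: eq_integral => x _.
  rewrite (eq_integral (fun r : mR => (\1_(`]0%R, k x[%classic : set mR) r)%:E)); last first.
    move=> r _; rewrite !indicE; congr (_%:R%:E); congr nat_of_bool.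
    apply/idP/idP; rewrite !inE /Ef /= in_itv/=.
      by move=> /andP[/andP[-> _] ->].
    move=> /andP[-> rk]; rewrite rk !andbT /=.
    by have /andP[_] := k01 x; exact: lt_le_trans.
  have /andP[k0 _] := k01 x; rewrite integral_indic// setIT.
  have : leb `]0, k x[%classic = (k x)%:E.
    rewrite lebesgue_measure_itv/= lte_fin -EFinB subr0.
    by case: ltgtP k0 => // <-.
  by move=> <-.
(* Only an inequality: [Eh] stops at height 1, while h may exceed it. *)
have layerh : (\int[leb]_r \int[leb]_x (\1_Eh (x, r))%:E <= \int[leb]_x h x)%E.
  rewrite -(fubini_tonelli (fun p => (\1_Eh p)%:E))//; last exact: indic.
  apply: ge0_le_integral => //.
  - by move=> x _; apply: integral_ge0 => r _; rewrite lee_fin.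
  - apply: (measurable_fun_fubini_tonelli_F (fun p => (\1_Eh p)%:E)) => //.
    exact: indic.
  move=> x _; case hx : (h x) => [c||]; last 2 first.
  - by rewrite leey.
  - by have := h0 x; rewrite hx.
  have c0 : 0 <= c by have := h0 x; rewrite hx lee_fin.
  apply: (@le_trans _ _ (\int[leb]_r (\1_(`]0%R, c]%classic : set mR) r)%:E)%E).
    apply: ge0_le_integral => //.
    - exact: (measurableT_comp (indic _ mEh) (pair1_measurable x)).
    - exact/measurable_EFinP/measurable_indic.
    move=> r _; rewrite lee_fin !indicE ler_nat.
    case: (boolP ((x, r) \in Eh)) => [|//]; rewrite inE /Eh /= hx lee_fin.
    move=> /andP[/andP[r0 _] rc]; rewrite mem_set//= in_itv/=.
    by rewrite r0 rc.
  rewrite integral_indic// setIT.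
  have : leb `]0, c]%classic = c%:E.
    rewrite lebesgue_measure_itv/= lte_fin -EFinB subr0.
    by case: ltgtP c0 => // <-.
  by move=> <-.
apply: le_trans layerh; rewrite (layer f)// (layer g)//.
have mG (E : set (mR * mR)) : measurable E ->
    measurable_fun setT (fun r => \int[leb]_x (\1_E (x, r))%:E)%E.
  move=> mE.
  by apply: (measurable_fun_fubini_tonelli_G (fun p => (\1_E p)%:E)) => //; exact: indic.
have G0 (E : set (mR * mR)) r : (0 <= \int[leb]_x (\1_E (x, r))%:E)%E.
  by apply: integral_ge0 => x _; rewrite lee_fin.
have l0' : (0 <= l%:E)%E by rewrite lee_fin ltW.
have l1' : (0 <= (1 - l)%:E)%E by rewrite lee_fin subr_ge0 ltW.
rewrite -!ge0_integralZl//; [|exact: mG (mEf _ mg)|exact: mG (mEf _ mf)].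
rewrite -ge0_integralD//; last 4 first.
- by move=> r _; rewrite mule_ge0.
- by apply: measurable_funeM; exact: mG (mEf _ mf).
- by move=> r _; rewrite mule_ge0.
- by apply: measurable_funeM; exact: mG (mEf _ mg).
apply: ge0_le_integral => //.
- by move=> r _; rewrite adde_ge0// mule_ge0.
- by apply: emeasurable_funD; apply: measurable_funeM; [exact: mG (mEf _ mf)|exact: mG (mEf _ mg)].
- exact: mG.
move=> r _.
have sec (E : set (mR * mR)) : measurable E ->
    measurable [set x | E (x, r)] /\
    (\int[leb]_x (\1_E (x, r))%:E = leb [set x | E (x, r)])%E.
  move=> mE; have mS : measurable [set x | E (x, r)].
    by rewrite -[X in measurable X]setTI; exact: (pair2_measurable r).
  split=> //.
  rewrite (eq_integral (fun x : mR => (\1_[set x | E (x, r)] x : R)%:E)).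
    by rewrite integral_indic// setIT.
  by move=> x _; rewrite !indicE; congr (_%:R%:E); congr nat_of_bool.
have [mSf ->] := sec _ (mEf _ mf); have [mSg ->] := sec _ (mEf _ mg).
have [mSh ->] := sec _ mEh.
have [r01|r01] := boolP ((0 < r) && (r < 1)); last first.
  have E0 k : [set x | Ef k (x, r)] = set0.
    by apply/seteqP; split => // x; rewrite /Ef /= (negbTE r01).
  by rewrite !E0 measure0 !mule0 adde0 measure_ge0.
have /andP[r0 r1] := r01.
apply: (@brunn_minkowski1 _ N) => //.
- by have [x fx] := f1 _ r1; exists x; rewrite /Ef /= r01.
- by have [x fx] := g1 _ r1; exists x; rewrite /Ef /= r01.
- move=> x; rewrite /Ef /= r01 /= => fx; rewrite leNgt; apply/negP => /fN fx0.
  by move: fx; rewrite fx0 ltNge ltW.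
- move=> x; rewrite /Ef /= r01 /= => fx; rewrite leNgt; apply/negP => /gN fx0.
  by move: fx; rewrite fx0 ltNge ltW.
- move=> x y; rewrite /Ef /Eh /= r01 /= => fx gy; exact: fgh.
Qed.

Import HBNNSimple.

(** Monotone convergence for simple approximations cut off to |x| <= n. Boundedness is needed to
    normalise the supremum, bounded support to have bounded superlevel sets. *)
Lemma integral_gt_bounded_support (f : mR -> \bar R) (a : R) :
  measurable_fun setT f -> (forall x, 0 <= f x)%E ->
  (a%:E < \int[leb]_x f x)%E ->
  exists (N : R) (k : mR -> R), [/\ measurable_fun setT k,
    (forall x, 0 <= k x <= N), (forall x, (k x)%:E <= f x)%E,
    (forall x, N < `|x| -> k x = 0) & (a%:E < \int[leb]_x (k x)%:E)%E].
Proof.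
move=> mf f0 af.
pose s := nnsfun_approx measurableT mf.
pose B n : set mR := [set x | `|x| <= n%:R].
pose k n (x : mR) : R := s n x * \1_(B n) x.
have mB n : measurable (B n).
  rewrite (_ : B n = `[- n%:R, n%:R]%classic)//.
  by apply/seteqP; split => x; rewrite /B /= in_itv/= ler_norml.
have mk n : measurable_fun setT (k n).
  by apply: measurable_funM => //; exact: measurable_indic.
have k0 n x : 0 <= k n x by rewrite mulr_ge0// fun_ge0.
have ks n x : k n x <= s n x.
  by rewrite ler_piMr ?fun_ge0// indicE lern1 leq_b1.
have sf x : (s n x)%:E @[n --> \oo] --> f x.
  by apply: cvg_nnsfun_approx => // y _; exact: f0.
have ndk x : {homo (fun n => (k n x)%:E) : m n / (m <= n)%N >-> (m <= n)%E}.
  move=> m n mn; rewrite lee_fin ler_pM ?fun_ge0//.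
    by have /lefP := nd_nnsfun_approx measurableT mf mn; exact.
  rewrite !indicE ler_nat; case: (boolP (x \in B m)) => // /set_mem xm.
  by rewrite mem_set//; apply: (le_trans xm); rewrite ler_nat.
have kf x : (k n x)%:E @[n --> \oo] --> f x.
  apply: cvg_trans (sf x); apply: near_eq_cvg.
  exists (Num.truncn `|x|).+1 => // n /= hn.
  rewrite /k indicE mem_set ?mulr1//; apply: ltW.
  by rewrite (lt_le_trans (truncnS_gt _))// ler_nat.
have cvg_k : (\int[leb]_x (k n x)%:E)%E @[n --> \oo] --> (\int[leb]_x f x)%E.
  rewrite (eq_integral (fun x => limn (fun n => (k n x)%:E))).
    apply: (@cvg_monotone_convergence _ _ _ leb setT measurableT
      (fun n x => (k n x)%:E)) => //.
    - by move=> n; exact/measurable_EFinP.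
    - by move=> n x _; rewrite lee_fin.
  by move=> x _; apply/esym/cvg_lim.
have [n an] : exists n, (a%:E < \int[leb]_x (k n x)%:E)%E.
  apply/not_existsP => h.
  have : (\int[leb]_x f x <= a%:E)%E.
    rewrite -(cvg_lim _ cvg_k)//; apply: lime_le; first by apply/cvg_ex; eexists; exact: cvg_k.
    by near=> n; rewrite leNgt; apply/negP; exact: h.
  by rewrite leNgt af.
have [M [_ hM]] := simple_bounded (s n).
have sM x : s n x <= `|M| + 1.
  have := hM (`|M| + 1); rewrite (le_lt_trans (ler_norm M)) ?ltrDl// => /(_ isT).
  by move=> /(_ x I); exact/le_trans/ler_norm.
exists (Num.max (`|M| + 1) n%:R), (k n); split => //.
- by move=> x; rewrite k0 le_max (le_trans (ks n x)).
- move=> x; apply: (@le_trans _ _ (s n x)%:E); first by rewrite lee_fin.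
  apply: (@le_trans _ _ (limn (fun n => (s n x)%:E))); last first.
    by rewrite (cvg_lim _ (sf x)).
  apply: lime_ge; first by apply/cvg_ex; exists (f x); exact: sf.
  by exists n => // m /= nm; rewrite lee_fin; exact/lefP/nd_nnsfun_approx.
- move=> x; rewrite gt_max => /andP[_ nx].
  by rewrite /k indicE memNset ?mulr0//; apply/negP; rewrite -ltNge.
Unshelve. all: by end_near.
Qed.

(** Levels exp a and exp b strictly below the values replace the powers f^l g^(1-l), so that the
    values 0 and +oo need no convention. The conclusion on integrals has the same form as the
    hypothesis on values, which is what lets the dimension induction go through. *)
Lemma prekopa_leindler1 (l : R) (f g h : mR -> \bar R) : 0 < l -> l < 1 ->
  measurable_fun setT f -> measurable_fun setT g -> measurable_fun setT h ->
  (forall x, 0 <= f x)%E -> (forall x, 0 <= g x)%E -> (forall x, 0 <= h x)%E ->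
  (forall x y a b, ((expR a)%:E < f x)%E -> ((expR b)%:E < g y)%E ->
    ((expR (l * a + (1 - l) * b))%:E <= h (l * x + (1 - l) * y)%R)%E) ->
  forall a b, ((expR a)%:E < \int[leb]_x f x)%E ->
    ((expR b)%:E < \int[leb]_x g x)%E ->
    ((expR (l * a + (1 - l) * b))%:E <= \int[leb]_x h x)%E.
Proof.
move=> l0 l1 mf mg mh f0 g0 h0 fgh a b af bg.
(* Here [s] is the logarithm of the supremum of k, which is positive because the integral of k
   is. *)
have norm (k : mR -> R) (N a' : R) : measurable_fun setT k -> (forall x, 0 <= k x <= N) ->
    ((expR a')%:E < \int[leb]_x (k x)%:E)%E ->
    exists s, (forall x, k x <= expR s) /\
      forall r, r < 1 -> exists x, r * expR s < k x.
  move=> mk k0N ak.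
  have hs : has_sup (range k).
    by split; [exists (k 0); exists 0|exists N => _ [x _ <-]; have /andP[] := k0N x].
  have ub x : k x <= sup (range k) by apply: sup_upper_bound => //; exists x.
  have S0 : 0 < sup (range k).
    rewrite ltNge; apply/negP => S0; move: ak.
    rewrite (eq_integral (cst 0%E)) ?integral0 ?lte_fin ?ltNge ?expR_ge0//.
    move=> x _; congr EFin; apply/le_anti; rewrite (le_trans (ub x))//=.
    by have /andP[] := k0N x.
  exists (ln (sup (range k))); rewrite lnK ?posrE//; split=> // r r1.
  have e0 : 0 < (1 - r) * sup (range k) by rewrite mulr_gt0// subr_gt0.
  have [_ [x _ <-] hx] := sup_adherent e0 hs.
  by exists x; apply: le_lt_trans hx; rewrite le_eqVlt; apply/orP; left; apply/eqP; ring.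
have [N1 [k1 [mk1 k1N k1f k1s k1a]]] := integral_gt_bounded_support mf f0 af.
have [N2 [k2 [mk2 k2N k2f k2s k2b]]] := integral_gt_bounded_support mg g0 bg.
have [s [k1_le k1_sup]] := norm _ _ _ mk1 k1N k1a.
have [t [k2_le k2_sup]] := norm _ _ _ mk2 k2N k2b.
set w := l * s + (1 - l) * t.
have es0 u : 0 < expR u :> R by exact: expR_gt0.
(* Dividing by the suprema e^s and e^t makes both equal to 1; h is divided by e^w, their weighted
   geometric mean. *)
have := @prekopa_leindler_normalized l (Num.max N1 N2)
  (fun x => k1 x * expR (- s)) (fun x => k2 x * expR (- t))
  (fun x => (expR (- w))%:E * h x)%E l0 l1.
have div01 (k : mR -> R) u : (forall x, k x <= expR u) -> (forall x : mR, 0 <= k x) ->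
    forall x, 0 <= k x * expR (- u) <= 1.
  move=> ku k0 x; rewrite mulr_ge0 ?expR_ge0//= expRN ler_pdivrMr// mul1r.
  exact: ku.
have n1 x : 0 <= k1 x by have /andP[] := k1N x.
have n2 x : 0 <= k2 x by have /andP[] := k2N x.
move=> /(_ _ _ _ (div01 _ _ k1_le n1) (div01 _ _ k2_le n2)).
have w0 : (0 <= (expR (- w))%:E :> \bar R)%E by rewrite lee_fin expR_ge0.
rewrite ge0_integralZl//.
have expand (k : mR -> R) u : measurable_fun setT k -> (forall x : mR, 0 <= k x) ->
    (\int[leb]_x (k x * expR (- u))%:E = (expR (- u))%:E * \int[leb]_x (k x)%:E)%E.
  move=> mk k0; rewrite -ge0_integralZl ?lee_fin ?expR_ge0//.
  - by apply: eq_integral => x _; rewrite -EFinM mulrC.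
  - exact/measurable_EFinP.
  - by move=> x _; rewrite lee_fin.
rewrite !expand// => H.
have {}H : (l%:E * ((expR (- s))%:E * \int[leb]_x (k1 x)%:E) +
    (1 - l)%:E * ((expR (- t))%:E * \int[leb]_x (k2 x)%:E) <=
    (expR (- w))%:E * \int[leb]_x h x)%E.
  apply: H.
  - by apply: measurable_funM.
  - by apply: measurable_funM.
  - exact: measurable_funeM.
  - by move=> x; rewrite mule_ge0.
  - by move=> x; rewrite gt_max => /andP[/k1s -> _]; rewrite mul0r.
  - by move=> x; rewrite gt_max => /andP[_ /k2s ->]; rewrite mul0r.
  - move=> r /k1_sup[x hx]; exists x.
    by rewrite expRN ltr_pdivlMr.
  - move=> r /k2_sup[x hx]; exists x.
    by rewrite expRN ltr_pdivlMr.
  - move=> x y r r0; rewrite !expRN !ltr_pdivlMr// => hx hy.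
    rewrite muleC lee_pdivlMr//.
    have hx' : ((expR (ln r + s))%:E < f x)%E.
      by apply: lt_le_trans (k1f x); rewrite lte_fin expRD lnK.
    have hy' : ((expR (ln r + t))%:E < g y)%E.
      by apply: lt_le_trans (k2f y); rewrite lte_fin expRD lnK.
    have := fgh _ _ _ _ hx' hy'.
    rewrite (_ : l * _ + _ = ln r + w); last by rewrite /w; ring.
    by rewrite expRD lnK ?posrE// EFinM.
have H2 : ((expR (l * (a - s) + (1 - l) * (b - t)))%:E <=
    (expR (- w))%:E * \int[leb]_x h x)%E.
  apply: le_trans H.
  apply: (@le_trans _ _ (l * expR (a - s) + (1 - l) * expR (b - t))%:E).
    by rewrite lee_fin expR_convex// ltW.
  rewrite EFinD !EFinM; apply: leeD.
    apply: lee_wpmul2l; first by rewrite lee_fin ltW.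
    rewrite expRD mulrC EFinM; apply: lee_wpmul2l; last exact: ltW.
    by rewrite lee_fin expR_ge0.
  apply: lee_wpmul2l; first by rewrite lee_fin subr_ge0 ltW.
  rewrite expRD mulrC EFinM; apply: lee_wpmul2l; last exact: ltW.
  by rewrite lee_fin expR_ge0.
move: H2; rewrite expRN muleC lee_pdivlMr// -EFinM -expRD.
by congr ((expR _)%:E <= _)%E; rewrite /w; ring.
Qed.

(** Induction on [d]: with the first coordinates fixed, the induction hypothesis says exactly that
    the inner integrals satisfy the hypothesis of [prekopa_leindler1]. *)
Lemma prekopa_leindler (l : R) d (f g h : d.-tuple R -> \bar R) : 0 < l -> l < 1 ->
  measurable_fun setT f -> measurable_fun setT g -> measurable_fun setT h ->
  (forall x, 0 <= f x)%E -> (forall x, 0 <= g x)%E -> (forall x, 0 <= h x)%E ->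
  (forall x y a b, ((expR a)%:E < f x)%E -> ((expR b)%:E < g y)%E ->
    ((expR (l * a + (1 - l) * b))%:E <= h (tcomb l x y))%E) ->
  forall a b, ((expR a)%:E < \int[lebRd R d]_x f x)%E ->
    ((expR b)%:E < \int[lebRd R d]_x g x)%E ->
    ((expR (l * a + (1 - l) * b))%:E <= \int[lebRd R d]_x h x)%E.
Proof.
move=> l0 l1; elim: d f g h => [|d IH] f g h mf mg mh f0 g0 h0 fgh a b.
  rewrite /= !integral_dirac// !diracT !mul1e => fa gb.
  by have := fgh _ _ _ _ fa gb; rewrite (tuple0 (tcomb _ _ _)).
rewrite !integral_lebRdS//.
apply: prekopa_leindler1 => //; try exact: measurable_lebRd_int_cons;
  try by move=> x; exact: integral_ge0.
move=> x y a' b'; apply: IH => //;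
  try by apply: measurableT_comp => //; exact: measurable_cons.
move=> t u a'' b'' ha hb.
by have := fgh _ _ _ _ ha hb; rewrite tcomb_cons.
Qed.

End PrekopaLeindler.

(** * The conditional laws *)

Section GaussianDomination.
Variable R : realType.

Lemma integral_gt0 d (T : measurableType d) (m : {measure set T -> \bar R})
    (F : T -> \bar R) : m setT != 0%E -> measurable_fun setT F ->
  (forall x, 0 < F x)%E -> (0 < \int[m]_x F x)%E.
Proof.
move=> mT mF F0; rewrite lt0e integral_ge0 ?andbT; last by move=> x _; exact/ltW.
apply/negP => /eqP I0; move/eqP: mT; apply.
have /(ae_eq_integral_abs m measurableT mF) : (\int[m]_x `|F x| = 0)%E.
  by rewrite -[RHS]I0; apply: eq_integral => x _; rewrite gee0_abs ?ltW.
move=> [A [mA A0 FA]]; apply: (subset_measure0 _ mA _ A0) => //.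
by move=> x _; apply: FA => /(_ I) Fx0; have := F0 x; rewrite Fx0 ltxx.
Qed.

Lemma lebRd_setT_neq0 d : lebRd R d setT != 0%E.
Proof.
have leb0 : @lebesgue_measure R setT != 0%E.
  by rewrite -set_itvNyy lebesgue_measure_itv.
elim: d => [|d IH]; first by rewrite /= diracT oner_neq0.
rewrite gt_eqF//.
have -> : lebRd R d.+1 setT = (\int[lebRd R d.+1]_t 1%:E)%E.
  by rewrite integral_cst// mul1e.
rewrite integral_lebRdS//.
apply: integral_gt0 => //.
by move=> x; apply: integral_gt0 => // t; rewrite lte_fin.
Qed.

Lemma lebRd_integral_gt0 d (F : d.-tuple R -> R) : measurable_fun setT F ->
  (forall x, 0 < F x) -> (0 < \int[lebRd R d]_x (F x)%:E)%E.
Proof.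
move=> mF F0; apply: integral_gt0 => //; first exact: lebRd_setT_neq0.
exact/measurable_EFinP.
Qed.

Lemma integral_prod_tnth d (p : R -> R) : measurable_fun setT p ->
  (forall x, 0 <= p x) -> (\int[@lebesgue_measure R]_x (p x)%:E = 1)%E ->
  (\int[lebRd R d]_z (\prod_(i < d) p (tnth z i))%:E = 1)%E.
Proof.
move=> mp p0 p1.
have mprod n : measurable_fun setT
    (fun z : n.-tuple R => (\prod_(i < n) p (tnth z i))%:E).
  apply/measurable_EFinP; apply: measurable_prod => i _.
  by apply: measurableT_comp => //; exact: measurable_tnth.
elim: d => [|d IH].
  rewrite /= integral_dirac//; last exact: mprod.
  by rewrite diracT mul1e big_ord0.
rewrite integral_lebRdS//; last by move=> z; rewrite lee_fin prodr_ge0.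
rewrite (eq_integral (fun x : measurableTypeR R => (p x)%:E))// => x _.
rewrite (eq_integral (fun z : d.-tuple R =>
    (p x)%:E * (\prod_(i < d) p (tnth z i))%:E)%E).
  rewrite ge0_integralZl ?lee_fin//; last 2 first.
  - exact: mprod.
  - by move=> z _; rewrite lee_fin prodr_ge0.
  by rewrite IH mule1.
move=> z _; rewrite -EFinM big_ord_recl; congr (_ * _)%:E.
by apply: eq_bigr => i _; rewrite tnthS.
Qed.

Lemma measurable_dist2 d : measurable_fun setT
  (fun p : d.-tuple R * d.-tuple R => dist2 p.1 p.2).
Proof.
apply: measurable_sum => i; apply: measurable_funX; apply: measurable_funB.
  exact: (measurableT_comp (measurable_tnth i) measurable_fst).
exact: (measurableT_comp (measurable_tnth i) measurable_snd).
Qed.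

Lemma dist2_ge0 d (x y : d.-tuple R) : 0 <= dist2 x y.
Proof. by apply: sumr_ge0 => i _; exact: sqr_ge0. Qed.

(** The affine lower bound on h splits over coordinates; each factor is dominated by a multiple of a
    normal density of variance 4 eta, wider than the original variance eta so as to absorb both the
    linear growth and the centre c. *)
Lemma exp_convex_gauss_lty d (h : d.-tuple R -> R) (eta : R) (c : d.-tuple R) :
  0 < eta -> convex_fun h ->
  (\int[lebRd R d]_z (expR (- h z - dist2 c z / (2 * eta)))%:E < +oo)%E.
Proof.
move=> eta0 ch.
have mh := convex_measurable ch.
have [K0 hK0] := convex_ge_affine ch.
pose K := `|K0|; have K_ge0 : 0 <= K by exact: normr_ge0.
pose s := 2 * Num.sqrt eta.
have s0 : s != 0 by rewrite gt_eqF// mulr_gt0 ?sqrtr_gt0.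
pose p := @normal_pdf R 0 s.
pose A i := expR (tnth c i ^+ 2 / (2 * eta) + 2 * K ^+ 2 * eta) / normal_peak s.
have peak0 : 0 < normal_peak s by exact: normal_peak_gt0.
(* The constant in [A] is what completing the two squares (2 c_i - x)^2 and (|x| - 4 K eta)^2 leaves
   over; the normal peak is divided out because [p] contains it. *)
have coord i x : expR (K * `|x| - (tnth c i - x) ^+ 2 / (2 * eta)) <= A i * p x.
  rewrite /A /p normal_pdfE// mulrA divfK ?gt_eqF// /normal_fun -expRD ler_expR.
  rewrite subr0 /s exprMn sqr_sqrtr; last exact: ltW.
  have -> : (2 ^+ 2 * eta) *+ 2 = 8 * eta by ring.
  rewrite -subr_ge0; set y := tnth c i.
  have -> : y ^+ 2 / (2 * eta) + 2 * K ^+ 2 * eta + - x ^+ 2 / (8 * eta) -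
     (K * `|x| - (y - x) ^+ 2 / (2 * eta)) =
     ((2 * y - x) ^+ 2 * 2 + (`|x| - 4 * K * eta) ^+ 2) / (8 * eta) +
     (x ^+ 2 - `|x| ^+ 2) / (8 * eta).
    by field; rewrite gt_eqF.
  rewrite real_normK ?num_real// subrr mul0r addr0.
  apply: divr_ge0; last by rewrite mulr_ge0// ltW.
  have := sqr_ge0 (2 * y - x); have := sqr_ge0 (`|x| - 4 * K * eta); lra.
have mp : measurable_fun setT p by exact: measurable_normal_pdf.
have p0 x : 0 <= p x by exact: normal_pdf_ge0.
have p1 : (\int[@lebesgue_measure R]_x (p x)%:E = 1)%E by exact: integral_normal_pdf.
have mprod : measurable_fun setT
    (fun z : d.-tuple R => (\prod_(i < d) p (tnth z i))%:E).
  apply/measurable_EFinP; apply: measurable_prod => i _.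
  by apply: measurableT_comp => //; exact: measurable_tnth.
pose C := expR K * \prod_(i < d) A i.
have A0 i : 0 <= A i by rewrite mulr_ge0 ?expR_ge0// invr_ge0 ltW.
have C0 : 0 <= C by rewrite mulr_ge0 ?expR_ge0// prodr_ge0.
apply: (@le_lt_trans _ _ (\int[lebRd R d]_z
    (C%:E * (\prod_(i < d) p (tnth z i))%:E))%E); last first.
  rewrite ge0_integralZl ?lee_fin//; last by move=> z _; rewrite lee_fin prodr_ge0.
  by rewrite (integral_prod_tnth d mp p0 p1) mule1 ltry.
apply: ge0_le_integral => //.
- apply/measurable_EFinP; apply: measurableT_comp => //.
  apply: measurable_funB; first exact: measurableT_comp.
  apply: measurable_funM => //.
  exact: (measurableT_comp (@measurable_dist2 d) (pair1_measurable c)).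
- exact: measurable_funeM.
move=> z _; rewrite -EFinM lee_fin /C -mulrA -big_split/=.
apply: (@le_trans _ _ (expR K * \prod_(i < d)
    expR (K * `|tnth z i| - (tnth c i - tnth z i) ^+ 2 / (2 * eta)))).
  rewrite -expR_sum -expRD ler_expR sumrB -mulr_sumr -mulr_suml /dist2.
  have := hK0 z; set S := \sum_(i < d) `|_|; set D := (\sum_(i < d) _) / _.
  have S0 : 0 <= S by exact: sumr_ge0.
  have : K0 * (1 + S) <= K * (1 + S) by rewrite ler_wpM2r ?ler_norm// addr_ge0.
  by rewrite !mulNr; lra.
apply: ler_wpM2l; first exact: expR_ge0.
apply: ler_prod => i _; rewrite expR_ge0/=; exact: coord.
Qed.

End GaussianDomination.

(** * The Gibbs conditional centred at c as a real expectation operator *)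

Section Kernel.
Variables (R : realType) (d : nat) (h : d.-tuple R -> R) (eta : R).
Hypothesis eta0 : 0 < eta.
Hypothesis ch : convex_fun h.
Local Notation m := (lebRd R d).
Implicit Types (c x z : d.-tuple R) (u v w : d.-tuple R -> R).

Definition gdens c z := expR (- h z - dist2 c z / (2 * eta)).

Lemma gdens_gt0 c z : 0 < gdens c z. Proof. exact: expR_gt0. Qed.

Lemma gdens_ge0 c z : 0 <= gdens c z. Proof. exact: expR_ge0. Qed.

Lemma measurable_gdens2 :
  measurable_fun setT (fun p : d.-tuple R * d.-tuple R => gdens p.1 p.2).
Proof.
apply: measurableT_comp => //; apply: measurable_funB.
  apply: measurableT_comp => //.
  exact: (measurableT_comp (convex_measurable ch) measurable_snd).
by apply: measurable_funM => //; exact: measurable_dist2.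
Qed.

Lemma measurable_gdens c : measurable_fun setT (gdens c).
Proof. exact: (measurableT_comp measurable_gdens2 (pair1_measurable c)). Qed.

Lemma measurable_dist2r c : measurable_fun setT (dist2 c).
Proof. exact: (measurableT_comp (@measurable_dist2 R d) (pair1_measurable c)). Qed.

Definition gint c u := m.-integrable setT (fun z => (u z * gdens c z)%:E).

Definition gZ c := \int[m]_z gdens c z.

Definition gmean c u := (\int[m]_z (u z * gdens c z)) / gZ c.

Lemma gintP c u : measurable_fun setT u ->
  (\int[m]_z (`|u z| * gdens c z)%:E < +oo)%E -> gint c u.
Proof.
move=> mu uoo; apply/integrableP; split.
  by apply/measurable_EFinP; apply: measurable_funM => //; exact: measurable_gdens.
rewrite (eq_integral (fun z => (`|u z| * gdens c z)%:E))// => z _.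
by rewrite /= normrM (ger0_norm (gdens_ge0 _ _)).
Qed.

Lemma gint1 c : gint c (cst 1).
Proof.
apply: gintP => //.
rewrite (eq_integral (fun z => (gdens c z)%:E)).
  exact: exp_convex_gauss_lty.
by move=> z _; rewrite normr1 mul1r.
Qed.

Lemma le_gint c u v : measurable_fun setT u -> gint c v ->
  (forall z, `|u z| <= v z) -> gint c u.
Proof.
move=> mu iv uv; apply: le_integrable iv => //.
  by apply/measurable_EFinP; apply: measurable_funM => //; exact: measurable_gdens.
move=> z _; rewrite /= lee_fin !normrM ler_wpM2r// (le_trans (uv z))// ler_norm//.
Qed.

Lemma gintZ c a u : gint c u -> gint c (fun z => a * u z).
Proof.
move=> /(integrableZl measurableT a); apply: eq_integrable => // z _.
by rewrite -EFinM mulrA.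
Qed.

Lemma gintD c u v : gint c u -> gint c v -> gint c (fun z => u z + v z).
Proof.
move=> iu iv; have := integrableD measurableT iu iv.
by apply: eq_integrable => // z _; rewrite -EFinD mulrDl.
Qed.

Lemma gint_cst c a : gint c (cst a).
Proof.
have := gintZ a (gint1 c); apply: eq_integrable => // z _.
by rewrite mulr1.
Qed.

Lemma gint_bounded c u M : measurable_fun setT u -> (forall z, `|u z| <= M) ->
  gint c u.
Proof. by move=> mu uM; apply: le_gint (gint_cst c M) _. Qed.

Lemma gZ_gt0 c : 0 < gZ c.
Proof.
apply: fine_gt0; apply/andP; split; last exact: exp_convex_gauss_lty.
apply: lebRd_integral_gt0; [exact: measurable_gdens|exact: gdens_gt0].
Qed.

Lemma EFin_gZ c : (gZ c)%:E = (\int[m]_z (gdens c z)%:E)%E.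
Proof.
rewrite fineK// ge0_fin_numE; first exact: exp_convex_gauss_lty.
by apply: integral_ge0 => z _; rewrite lee_fin gdens_ge0.
Qed.

Lemma EFin_gmean c u : gint c u ->
  (gmean c u * gZ c)%:E = (\int[m]_z (u z * gdens c z)%:E)%E.
Proof.
move=> iu; rewrite divfK ?gt_eqF ?gZ_gt0// fineK//.
exact: integrable_fin_num.
Qed.

Lemma eq_gmean c u v : u =1 v -> gmean c u = gmean c v.
Proof. by move=> uv; congr (_ / _); apply: eq_Rintegral => z _; rewrite uv. Qed.

Lemma gmeanZ c a u : gint c u -> gmean c (fun z => a * u z) = a * gmean c u.
Proof.
move=> iu; rewrite /gmean mulrA -RintegralZl//; congr (_ / _).
by apply: eq_Rintegral => z _; rewrite mulrA.
Qed.

Lemma gmeanD c u v : gint c u -> gint c v ->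
  gmean c (fun z => u z + v z) = gmean c u + gmean c v.
Proof.
move=> iu iv; rewrite /gmean -mulrDl -RintegralD//; congr (_ / _).
by apply: eq_Rintegral => z _; rewrite mulrDl.
Qed.

Lemma gmean_cst c a : gmean c (cst a) = a.
Proof.
rewrite -[a]mulr1 [LHS](_ : _ = gmean c (fun=> a * (cst 1 (c : d.-tuple R)))) //.
rewrite (gmeanZ a (gint1 c)); congr (_ * _).
rewrite /gmean [X in X / _](_ : _ = gZ c) ?divff ?gt_eqF ?gZ_gt0//.
by apply: eq_Rintegral => z _; rewrite mul1r.
Qed.

Lemma le_gmean c u v : gint c u -> gint c v -> (forall z, u z <= v z) ->
  gmean c u <= gmean c v.
Proof.
move=> iu iv uv; rewrite /gmean ler_pM2r ?invr_gt0 ?gZ_gt0//.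
by apply: le_Rintegral => // z _; rewrite ler_wpM2r ?gdens_ge0.
Qed.

(** Integrate the tangent line of the exponential at the mean [a] of w. *)
Lemma gmean_jensen c w : gint c w -> gint c (fun z => expR (w z)) ->
  expR (gmean c w) <= gmean c (fun z => expR (w z)).
Proof.
move=> iw ie; set a := gmean c w.
have i1w := gintD (gint_cst c (1 - a)) iw.
apply: (@le_trans _ _ (gmean c (fun z => expR a * ((1 - a) + w z)))).
  rewrite (gmeanZ _ i1w) (gmeanD (gint_cst c (1 - a)) iw) gmean_cst.
  by rewrite -/a subrK mulr1.
apply: le_gmean => //; first exact: gintZ.
move=> z; have -> : expR (w z) = expR a * expR (w z - a).
  by rewrite -expRD; congr expR; ring.
rewrite ler_wpM2l ?expR_ge0// (le_trans _ (expR_ge1Dx _))//; lra.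
Qed.

End Kernel.

(** * The log-Harnack inequality *)

(** The difference quotient of s |-> exp (s X) at 0 with step 1 / n, bounded by the derivative X
    plus an explicit error of order 1 / n. The error involves only exponential moments of X, which
    are finite where this is used. *)
Lemma expR_scaled_le (R : realType) (X n : R) : 1 <= n ->
  n * (expR (n^-1 * X) - 1) <= X + 4 / n * (expR (2 * X) + expR (- 2 * X)).
Proof.
move=> n1; have n0 : 0 < n by lra.
set z := n^-1 * X; have Xz : X = n * z by rewrite /z mulrA mulfV ?mul1r ?gt_eqF.
(* From (1 + y / 2)^2 <= exp y; this 4 is the one in the statement. *)
have sq (y : R) : 0 <= y -> y ^+ 2 <= 4 * expR y.
  move=> y0; have h : 1 + y / 2 <= expR (y / 2) by exact: expR_ge1Dx.
  have -> : expR y = expR (y / 2) ^+ 2.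
    by rewrite expr2 -expRD; congr expR; field.
  have : (1 + y / 2) ^+ 2 <= expR (y / 2) ^+ 2 by rewrite lerXn2r// nnegrE; lra.
  by nra.
have tangent (y : R) : expR y - 1 <= y * expR y.
  have h : 1 - y <= expR (- y) by exact: expR_ge1Dx.
  have : (1 - y) * expR y <= expR (- y) * expR y.
    by rewrite ler_wpM2r// expR_ge0.
  by rewrite -expRD addNr expR0; lra.
have e1 := expR_gt0 (2 * X); have e2 := expR_gt0 (- 2 * X).
have nz : n * (expR z - 1) <= X * expR z.
  by rewrite {1}Xz -mulrA ler_wpM2l// ltW.
have key : X * (expR z - 1) <= X ^+ 2 / n * expR `|X|.
  have -> : X ^+ 2 / n = X * z by rewrite /z; ring.
  have [X0|X0] := leP 0 X.
    have z0 : 0 <= z by rewrite mulr_ge0// invr_ge0 ltW.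
    rewrite ger0_norm// -mulrA ler_wpM2l//.
    apply: le_trans (tangent z) _; rewrite ler_wpM2l// ler_expR /z.
    by rewrite ler_piMl// invf_le1.
  have z0 : z <= expR z - 1 by have := expR_ge1Dx z; lra.
  apply: (@le_trans _ _ (X * z)); first by rewrite ler_nM2l.
  have Xz0 : 0 <= X * z by rewrite Xz -mulrA mulr_ge0 ?sqr_ge0 // ltW.
  by rewrite ler_peMr// -expR0 ler_expR.
have sqX := sq `|X| (normr_ge0 X).
have bound : X ^+ 2 * expR `|X| <= 4 * (expR (2 * X) + expR (- 2 * X)).
  apply: (@le_trans _ _ (4 * expR (2 * `|X|))).
    have -> : expR (2 * `|X|) = expR `|X| * expR `|X|.
      by rewrite -expRD; congr expR; ring.
    by rewrite mulrA ler_wpM2r ?expR_ge0// -[X ^+ 2]real_normK ?num_real.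
  have [X0|X0] := leP 0 X; first by rewrite ger0_norm//; lra.
  by rewrite ltr0_norm// mulrN -mulNr; lra.
have : X ^+ 2 / n * expR `|X| <= 4 / n * (expR (2 * X) + expR (- 2 * X)).
  by rewrite mulrAC [leRHS]mulrAC ler_wpM2r// invr_ge0 ltW.
lra.
Qed.

(** For finite positive integrals the levels can be taken as the logarithms of the integrals lowered
    by e, which makes them strict; then e tends to 0. *)
Lemma prekopa_leindler_ln (R : realType) d (l : R) (f g h : d.-tuple R -> R) :
  0 < l -> l < 1 ->
  measurable_fun setT f -> measurable_fun setT g -> measurable_fun setT h ->
  (\int[lebRd R d]_z (expR (f z))%:E < +oo)%E ->
  (\int[lebRd R d]_z (expR (g z))%:E < +oo)%E ->
  (\int[lebRd R d]_z (expR (h z))%:E < +oo)%E ->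
  (forall x y, l * f x + (1 - l) * g y <= h (tcomb l x y)) ->
  l * ln (\int[lebRd R d]_z expR (f z)) + (1 - l) * ln (\int[lebRd R d]_z expR (g z))
    <= ln (\int[lebRd R d]_z expR (h z)).
Proof.
move=> l0 l1 mf mg mh foo goo hoo fgh.
have me (k : d.-tuple R -> R) : measurable_fun setT k ->
    measurable_fun setT (fun z : d.-tuple R => (expR (k z))%:E).
  by move=> mk; apply/measurable_EFinP; exact: measurableT_comp.
have pos (k : d.-tuple R -> R) : measurable_fun setT k -> (\int[lebRd R d]_z (expR (k z))%:E < +oo)%E ->
    0 < \int[lebRd R d]_z expR (k z) /\
    (\int[lebRd R d]_z (expR (k z))%:E = (\int[lebRd R d]_z expR (k z))%:E)%E.
  move=> mk koo; have k0 : (0 < \int[lebRd R d]_z (expR (k z))%:E)%E.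
    by apply: lebRd_integral_gt0; [exact: measurableT_comp|move=> z; exact: expR_gt0].
  split; first by apply: fine_gt0; rewrite k0.
  by rewrite fineK// ge0_fin_numE// ltW.
have [F0 FE] := pos _ mf foo; have [G0 GE] := pos _ mg goo.
have [H0 HE] := pos _ mh hoo.
apply/ler_addgt0Pr => e e0.
set a := ln (\int[lebRd R d]_z expR (f z)); set b := ln (\int[lebRd R d]_z expR (g z)).
have : ((expR (l * (a - e) + (1 - l) * (b - e)))%:E <=
    \int[lebRd R d]_z (expR (h z))%:E)%E.
  have e0' k (x : d.-tuple R) : (0 <= (expR (k x))%:E :> \bar R)%E.
    by rewrite lee_fin expR_ge0.
  have := prekopa_leindler l0 l1 (me _ mf) (me _ mg) (me _ mh) (e0' f) (e0' g) (e0' h).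
  apply.
  - move=> x y a' b'; rewrite !lte_fin lee_fin !ltr_expR ler_expR => xa yb.
    apply: le_trans (fgh x y); apply: lerD; apply: ler_wpM2l => //; try exact: ltW.
    by rewrite subr_ge0 ltW.
  - by rewrite FE lte_fin -[X in _ < X]lnK ?posrE// ltr_expR ltrBlDr ltrDl.
  - by rewrite GE lte_fin -[X in _ < X]lnK ?posrE// ltr_expR ltrBlDr ltrDl.
rewrite HE lee_fin -ler_ln ?posrE ?expR_gt0// expRK.
by move: (ln _) a b => c a b; clear; lra.
Qed.

Lemma frac_cancel (K : fieldType) (a b c : K) : a != 0 ->
  a / b * (c / a) = c / b.
Proof. by move=> a0; rewrite mulrC mulrA divfK. Qed.

Lemma harnack_arith (K : realFieldType) (lx ly lq a b c : K) :
  a + b - c <= lq -> ly - lx <= b -> a <= lx - ly + lq + c.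
Proof. lra. Qed.

Lemma convex_comb_cancel (K : realFieldType) (t a b c : K) :
  t * (a + b) + (1 - t) * a <= a + c -> t * b <= c.
Proof. lra. Qed.

(** For a concave function with end values b and a, the total increment is at most N times any bound
    q on the increment over the first N-th of the segment. *)
Lemma chord_slope (R : realType) (N a b q : R) : 0 < N ->
  N^-1 * a + (1 - N^-1) * b <= b + q -> a - b <= N * q.
Proof.
move=> N0; rewrite -(ler_pM2l N0).
have -> : N * (N^-1 * a + (1 - N^-1) * b) = a - b + N * b.
  by field; rewrite gt_eqF.
by rewrite mulrDr; lra.
Qed.

Section Harnack.
Variables (R : realType) (d : nat) (h : d.-tuple R -> R) (eta : R).
Hypothesis eta0 : 0 < eta.
Hypothesis ch : convex_fun h.
Local Notation m := (lebRd R d).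
Implicit Types (c x z : d.-tuple R) (u v w : d.-tuple R -> R).
Local Notation gdens := (gdens h eta).
Local Notation gint := (gint h eta).
Local Notation gZ := (gZ h eta).
Local Notation gmean := (gmean h eta).

Let gexpo c z := - h z - dist2 c z / (2 * eta).

Let measurable_gexpo c : measurable_fun setT (gexpo c).
Proof.
apply: measurable_funB.
  by apply: measurableT_comp => //; exact: convex_measurable.
by apply: measurable_funM => //; exact: measurable_dist2r.
Qed.

(** The exponent h z + |x - z|^2 / (2 eta) is jointly convex in (x, z), so its marginal in x is
    log-concave by Prékopa-Leindler. *)
Lemma ln_gZ_concave (l : R) x y : 0 < l -> l < 1 ->
  l * ln (gZ x) + (1 - l) * ln (gZ y) <= ln (gZ (tcomb l x y)).
Proof.
move=> l0 l1; apply: prekopa_leindler_ln => //; try exact: measurable_gexpo;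
  try exact: exp_convex_gauss_lty.
move=> z w.
have hzw := ch z w (ltW l0) (ltW l1).
have D : dist2 (tcomb l x y) (tcomb l z w) <= l * dist2 x z + (1 - l) * dist2 y w.
  rewrite /dist2 !mulr_sumr -big_split/=; apply: ler_sum => i _; rewrite !tcombE.
  set a := tnth x i - tnth z i; set b := tnth y i - tnth w i.
  rewrite -subr_ge0 [X in 0 <= X](_ : _ = l * (1 - l) * (a - b) ^+ 2).
    by apply: mulr_ge0 (sqr_ge0 _); apply: mulr_ge0; lra.
  rewrite /a /b; ring.
have e0 : 0 < (2 * eta)^-1 by rewrite invr_gt0 mulr_gt0.
have := ler_wpM2r (ltW e0) D.
rewrite mulrDl; lra.
Qed.

Section tilt.
Variables x y : d.-tuple R.

(** Derivative at t = 0 of the log-density at z when the centre moves from x towards y. Moving the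
    centre is an exponential tilt by t X, up to the constant t^2 D. *)
Let X z := (\sum_(i < d) (tnth z i - tnth x i) * (tnth y i - tnth x i)) / eta.
Let D := dist2 x y / (2 * eta).

Let mX : measurable_fun setT X.
Proof.
apply: measurable_funM => //; apply: measurable_sum => i.
apply: measurable_funM => //; apply: measurable_funB => //.
exact: measurable_tnth.
Qed.

Lemma gdens_tilt t z :
  gdens (tcomb t y x) z = expR (t * X z - t ^+ 2 * D) * gdens x z.
Proof.
rewrite -expRD; congr expR.
have -> : dist2 (tcomb t y x) z = dist2 x z -
    2 * t * (\sum_(i < d) (tnth z i - tnth x i) * (tnth y i - tnth x i)) +
    t ^+ 2 * dist2 x y.
  rewrite /dist2 !mulr_sumr -sumrB -big_split/=; apply: eq_bigr => i _.
  by rewrite tcombE; ring.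
by rewrite /X /D; field; rewrite gt_eqF.
Qed.

(** The tilted density is a constant times the density centred at [tcomb t y x], hence
    integrable. *)
Lemma gint_expX t : gint x (fun z => expR (t * X z)).
Proof.
have := gint_cst eta0 ch (tcomb t y x) (expR (t ^+ 2 * D)).
apply: eq_integrable => // z _; rewrite gdens_tilt mulrA -expRD.
by congr (expR _ * _)%:E; ring.
Qed.

Lemma gint_X : gint x X.
Proof.
apply: (le_gint ch mX (gintD (gint_expX 1) (gint_expX (- 1)))) => z.
rewrite mul1r mulN1r.
have := expR_ge1Dx (X z); have := expR_ge1Dx (- X z).
have := expR_gt0 (X z); have := expR_gt0 (- X z).
by rewrite ler_norml; lra.
Qed.

Lemma gZ_tilt t : gZ (tcomb t y x) = gZ x * gmean x (fun z => expR (t * X z - t ^+ 2 * D)).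
Proof.
rewrite /gmean mulrC divfK ?gt_eqF ?gZ_gt0//.
by apply: eq_Rintegral => z _; exact: gdens_tilt.
Qed.

Lemma tcomb1 : tcomb 1 y x = y.
Proof. by apply: eq_from_tnth => i; rewrite tcombE; ring. Qed.

(** The right-hand side is the derivative of ln Z at x in the direction y - x, and a concave
    function lies below its tangent. The derivative is reached through difference quotients of step
    1 / N with error 4 K / N. *)
Lemma ln_gZ_le : ln (gZ y) - ln (gZ x) <= gmean x X.
Proof.
pose K := gmean x (fun z => expR (2 * X z)) + gmean x (fun z => expR (- 2 * X z)).
have K0 : 0 <= K.
  by rewrite addr_ge0// mulr_ge0 ?invr_ge0 ?(ltW (gZ_gt0 eta0 ch x))//;
    apply: Rintegral_ge0 => z _; rewrite mulr_ge0 ?expR_ge0 ?gdens_ge0.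
have step n : ln (gZ y) - ln (gZ x) <= gmean x X + 4 / n.+2%:R * K.
  (* The shift by two gives N > 1, so that the weight 1 / N is strictly inside ]0, 1[. *)
  set N : R := n.+2%:R.
  have N1 : 1 < N by rewrite ltr1n.
  have N0 : 0 < N by lra.
  have l0 : 0 < N^-1 by rewrite invr_gt0.
  have l1 : N^-1 < 1 by rewrite invf_lt1.
  have conc := ln_gZ_concave y x l0 l1.
  have iN := gint_expX N^-1.
  have i2 := gint_expX 2; have iN2 := gint_expX (- 2).
  have D0 : 0 <= D by rewrite mulr_ge0 ?dist2_ge0// invr_ge0 mulr_ge0// ltW.
  (* The factor exp (- D / N^2) <= 1 is dropped; being of second order, it does not affect the
     limit. *)
  have le1 : gZ (tcomb N^-1 y x) <= gZ x * gmean x (fun z => expR (N^-1 * X z)).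
    rewrite gZ_tilt ler_pM2l ?gZ_gt0//; apply: le_gmean => //.
      apply: (le_gint ch _ iN).
        apply: measurableT_comp => //; apply: measurable_funB => //.
        exact: measurable_funM.
      move=> z; rewrite ger0_norm ?expR_ge0// ler_expR gerBl mulr_ge0//.
      exact: sqr_ge0.
    by move=> z; rewrite ler_expR gerBl mulr_ge0// sqr_ge0.
  have q0 : 0 < gmean x (fun z => expR (N^-1 * X z)).
    have := lt_le_trans (gZ_gt0 eta0 ch (tcomb N^-1 y x)) le1.
    by rewrite pmulr_rgt0// gZ_gt0.
  have le2 : ln (gZ (tcomb N^-1 y x)) <=
      ln (gZ x) + (gmean x (fun z => expR (N^-1 * X z)) - 1).
    apply: (@le_trans _ _ (ln (gZ x * gmean x (fun z => expR (N^-1 * X z))))).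
      rewrite ler_ln ?posrE//; first exact: gZ_gt0.
      by rewrite mulr_gt0 ?gZ_gt0.
    rewrite lnM ?posrE ?gZ_gt0// lerD2l.
    have := expR_ge1Dx (ln (gmean x (fun z => expR (N^-1 * X z)))).
    by rewrite lnK ?posrE// lerBrDl.
  have le3 : N * (gmean x (fun z => expR (N^-1 * X z)) - 1) <=
      gmean x X + 4 / N * K.
    have -> : N * (gmean x (fun z => expR (N^-1 * X z)) - 1) =
        gmean x (fun z => N * (expR (N^-1 * X z) + - 1)).
      rewrite (gmeanZ _ (gintD iN (gint_cst eta0 ch x (- 1)))).
      by rewrite (gmeanD iN (gint_cst eta0 ch x (- 1))) gmean_cst.
    have -> : gmean x X + 4 / N * K =
        gmean x (fun z => X z + 4 / N * (expR (2 * X z) + expR (- 2 * X z))).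
      rewrite (gmeanD gint_X (gintZ _ (gintD i2 iN2))).
      by rewrite (gmeanZ _ (gintD i2 iN2)) (gmeanD i2 iN2).
    apply: le_gmean => //.
    - by apply: gintZ; exact: gintD iN (gint_cst eta0 ch x (- 1)).
    - by apply: gintD gint_X _; apply: gintZ; exact: gintD.
    - by move=> z; apply: expR_scaled_le; exact: ltW.
  exact: le_trans (chord_slope N0 (le_trans conc le2)) le3.
apply/ler_addgt0Pr => e e0.
pose n := Num.truncn (e^-1 * (4 * K)).
apply: le_trans (step n) _; rewrite lerD2l mulrAC ler_pdivrMr//.
rewrite -ler_pdivrMl// ltW// (lt_le_trans (truncnS_gt _))//.
by rewrite ler_nat.
Qed.

(* This is the bound KL(Q_x || Q_y) <= |x - y|^2 / (2 eta) in Donsker-Varadhan form;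
   concavity of ln Z controls the normalising constants. *)
Lemma harnack0 v B : measurable_fun setT v -> (forall z, `|v z| <= B) ->
  gmean x v <= ln (gmean y (fun z => expR (v z))) + D.
Proof.
move=> mv vB.
have iv := gint_bounded eta0 ch x mv vB.
(* Change of measure from Q_y to Q_x, the tilt with t = 1. Jensen under Q_x then produces the mean
   of v + X - D, and [ln_gZ_le] cancels the mean of X against ln Z(x) - ln Z(y). *)
have gE : gmean y (fun z => expR (v z)) =
    gZ x / gZ y * gmean x (fun z => expR ((v z + X z) + - D)).
  have key : \int[m]_z (expR (v z) * gdens y z) =
      \int[m]_z (expR ((v z + X z) + - D) * gdens x z).
    apply: eq_Rintegral => z _.
    by rewrite -{1}tcomb1 gdens_tilt mulrA -expRD; congr (expR _ * _); ring.
  by rewrite /gmean key frac_cancel; last by rewrite gt_eqF ?gZ_gt0.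
have iw : gint x (fun z => (v z + X z) + - D).
  apply: gintD; first exact: gintD gint_X.
  exact: (gint_cst eta0 ch x (- D)).
have ie : gint x (fun z => expR ((v z + X z) + - D)).
  have D0 : 0 <= D by rewrite mulr_ge0 ?dist2_ge0// invr_ge0 mulr_ge0// ltW.
  apply: (le_gint ch _ (gintZ (expR B) (gint_expX 1))).
    apply: measurableT_comp => //; apply: measurable_funD => //.
    exact: measurable_funD.
  move=> z; rewrite ger0_norm ?expR_ge0// -expRD ler_expR.
  by have := vB z; rewrite ler_norml mul1r -addrA => /andP[_ ?]; apply: lerD => //; rewrite gerBl.
have J := gmean_jensen eta0 ch iw ie.
have mw : gmean x (fun z => (v z + X z) + - D) = gmean x v + gmean x X - D.
  rewrite (gmeanD (gintD iv gint_X) (gint_cst eta0 ch x (- D))) gmean_cst//.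
  by rewrite (gmeanD iv gint_X).
have Zx : gZ x \is Num.pos by rewrite posrE gZ_gt0.
have Zy : gZ y \is Num.pos by rewrite posrE gZ_gt0.
have Zxy : gZ x / gZ y \is Num.pos by rewrite posrE divr_gt0 ?gZ_gt0.
have q0 : gmean x (fun z => expR ((v z + X z) + - D)) \is Num.pos.
  by rewrite posrE (lt_le_trans (expR_gt0 _) J).
rewrite gE (lnM Zxy q0) (ln_div Zx Zy); apply: harnack_arith ln_gZ_le.
by rewrite -mw -ler_expR lnK.
Qed.

End tilt.

(** Here n counts the half-steps already made. Applying [harnack0] to F / t costs |x - y|^2 / (2
    eta) whatever t is, so multiplying back by t divides this cost by n + 1; Prékopa-Leindler
    removes the power 1 / t that the rescaling introduced. *)
Lemma harnack_step (n : nat) (F phi : d.-tuple R -> R) (B : R) (x y : d.-tuple R) :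
  (0 < n)%N -> measurable_fun setT F -> measurable_fun setT phi ->
  (forall z, 0 <= F z <= B) -> (forall z, 1 <= phi z <= expR B) ->
  (forall z z', F z <= ln (phi z') + dist2 z z' / (2 * eta * n%:R)) ->
  gmean x F <= ln (gmean y phi) + dist2 x y / (2 * eta * n.+1%:R).
Proof.
move=> n0 mF mphi FB phiB Fphi.
set t : R := n.+1%:R^-1.
have t0 : 0 < t by rewrite invr_gt0.
have t1 : t < 1 by rewrite invf_lt1 ?ltr1n.
have tE : t^-1 = n.+1%:R by rewrite invrK.
have FM z : `|F z / t| <= B / t.
  have /andP[F0 FB'] := FB z.
  by rewrite normrM normfV (gtr0_norm t0) (ger0_norm F0) ler_wpM2r// invr_ge0 ltW.
have mFt : measurable_fun setT (fun z => F z / t) by exact: measurable_funM.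
have B0 := harnack0 x y mFt FM.
have lnphiM z : 0 <= ln (phi z) <= B.
  have /andP[p1 pB] := phiB z; rewrite ln_ge0//=.
  by rewrite -[leRHS]expRK ler_ln ?posrE ?expR_gt0//; lra.
have phiE z : phi z * gdens y z = expR (ln (phi z) + gexpo y z).
  by rewrite expRD lnK// posrE; have /andP[] := phiB z; lra.
have phi_lty (u : d.-tuple R -> R) : gint y u -> (forall z, 0 < u z) ->
    (\int[m]_z (u z * gdens y z)%:E < +oo)%E.
  by move=> iu u0; rewrite -EFin_gmean// ltry.
have iphi : gint y phi.
  apply: (@gint_bounded _ _ _ _ eta0 ch _ _ (expR B)) => // z.
  by have /andP[p1 pB] := phiB z; rewrite ger0_norm//; lra.
have iexp : gint y (fun z => expR (F z / t)).
  apply: (@gint_bounded _ _ _ _ eta0 ch _ _ (expR (B / t))); first exact: measurableT_comp.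
  move=> z; rewrite ger0_norm ?expR_ge0// ler_expR.
  by apply: le_trans (FM z); exact: ler_norm.
have ZyN := gZ_gt0 eta0 ch y.
(* All three functions carry the same weight centred at y; the second one is the bare weight, so
   after dividing by Z(y) only the tilted means remain. *)
have PL : t * ln (\int[m]_z expR (F z / t + gexpo y z)) + (1 - t) * ln (gZ y) <=
    ln (\int[m]_z expR (ln (phi z) + gexpo y z)).
  apply: prekopa_leindler_ln => //.
  - by apply: measurable_funD => //; exact: measurable_gexpo.
  - exact: measurable_gexpo.
  - apply: measurable_funD; last exact: measurable_gexpo.
    exact: (measurableT_comp (@measurable_ln R) mphi).
  - rewrite (eq_integral (fun z => (expR (F z / t) * gdens y z)%:E)).
      by apply: phi_lty => // z; exact: expR_gt0.
    by move=> z _; rewrite expRD.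
  - exact: exp_convex_gauss_lty.
  - rewrite (eq_integral (fun z => (phi z * gdens y z)%:E)).
      by apply: phi_lty => // z; have /andP[] := phiB z; lra.
    by move=> z _; rewrite phiE.
  - move=> z w.
    have hzw := ch z w (ltW t0) (ltW t1).
    have := Fphi z (tcomb t z w).
    (* This is (1 - t)^2 / n = t (1 - t), the identity that singles out t = 1 / (n + 1). *)
    have -> : dist2 z (tcomb t z w) / (2 * eta * n%:R) =
        t * (1 - t) * dist2 z w / (2 * eta).
      have -> : dist2 z (tcomb t z w) = (1 - t) ^+ 2 * dist2 z w.
        rewrite /dist2 mulr_sumr; apply: eq_bigr => i _; rewrite tcombE; ring.
      have -> : t = (n%:R + 1)^-1 by rewrite /t -natr1.
      have nr0 : 0 < n%:R :> R by rewrite ltr0n.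
      by field; rewrite !gt_eqF//; lra.
    (* Strong convexity of the squared distance, as an equality; its last term pays for the cost in
       the hypothesis on F. *)
    have DE : dist2 y (tcomb t z w) =
        t * dist2 y z + (1 - t) * dist2 y w - t * (1 - t) * dist2 z w.
      rewrite /dist2 !mulr_sumr -big_split -sumrB/=; apply: eq_bigr => i _.
      by rewrite tcombE; ring.
    rewrite /gexpo DE.
    set e := (2 * eta)^-1; set u := F z.
    have -> : t * (u / t + (- h z - dist2 y z * e)) =
        u + t * (- h z - dist2 y z * e) by field; rewrite gt_eqF.
    by rewrite !mulrDl !mulNr; lra.
have EF : \int[m]_z expR (F z / t + gexpo y z) =
    gZ y * gmean y (fun z => expR (F z / t)).
  rewrite /gmean mulrC divfK ?gt_eqF//.
  by apply: eq_Rintegral => z _; rewrite expRD.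
have EP : \int[m]_z expR (ln (phi z) + gexpo y z) = gZ y * gmean y phi.
  rewrite /gmean mulrC divfK ?gt_eqF//.
  by apply: eq_Rintegral => z _; rewrite -phiE.
have q1 : gmean y (fun z => expR (F z / t)) \is Num.pos.
  rewrite posrE (lt_le_trans ltr01)// -[leLHS](gmean_cst eta0 ch y); apply: le_gmean => //.
    exact: gint_cst.
  move=> z /=; rewrite -expR0 ler_expR divr_ge0 ?(ltW t0)//.
  by have /andP[] := FB z.
have q2 : gmean y phi \is Num.pos.
  rewrite posrE (lt_le_trans ltr01)// -[leLHS](gmean_cst eta0 ch y); apply: le_gmean => //.
    exact: gint_cst.
  by move=> z /=; have /andP[] := phiB z.
have Zpos : gZ y \is Num.pos by rewrite posrE.
move: PL; rewrite EF EP (lnM Zpos q1) (lnM Zpos q2) => /convex_comb_cancel PL.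
have iF : gint x F.
  apply: (@gint_bounded _ _ _ _ eta0 ch _ _ (B)) => // z.
  by have /andP[F0 FB'] := FB z; rewrite ger0_norm.
have gF : gmean x (fun z => F z / t) = t^-1 * gmean x F.
  by rewrite -gmeanZ//; apply: eq_gmean => z; rewrite mulrC.
have -> : gmean x F = t * gmean x (fun z => F z / t).
  by rewrite gF mulrA mulfV ?mul1r// gt_eqF.
have -> : dist2 x y / (2 * eta * n.+1%:R) = t * (dist2 x y / (2 * eta)).
  by rewrite [(2 * eta * n.+1%:R)^-1]invfM [LHS]mulrA [LHS]mulrC.
apply: le_trans (ler_wpM2l (ltW t0) B0) _.
by rewrite mulrDr lerD2r.
Qed.

End Harnack.

(** * Integration against kernels *)

Section Extension.
Context (R : realType) (d1 d2 d3 : measure_display) (S : measurableType d1)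
  (T : measurableType d2) (U : measurableType d3).
Variables (ls : {sigma_finite_measure set S -> \bar R})
  (lt : {sigma_finite_measure set T -> \bar R}) (mu : probability U R).
Variables (k : S * T -> R) (Phi : S * T -> U).
Hypotheses (mk : measurable_fun setT k) (k0 : forall p, 0 <= k p).
Hypothesis mPhi : measurable_fun setT Phi.
Hypothesis muE : forall A, measurable A ->
  mu A = (\int[ls]_s \int[lt]_t (\1_A (Phi (s, t)) * k (s, t))%:E)%E.
Local Notation mR := (measurableTypeR R).
Local Notation leb := (@lebesgue_measure R).

Lemma layer_cake (c : \bar R) : (0 <= c)%E ->
  (\int[leb]_r (\1_[set r : mR | ((0 : R) < r)%R && ((r : R)%:E < c)%E] r)%:E = c)%E.
Proof.
have meas (i : interval R) : (\int[leb]_r (\1_([set` i] : set mR) r)%:E)%E = leb [set` i].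
  by rewrite integral_indic ?setIT.
case: c => [c||]// c0.
  rewrite (_ : mkset _ = [set` `]0, c[ ]); last first.
    by apply/seteqP; split => r /=; rewrite in_itv/= lte_fin.
  rewrite meas lebesgue_measure_itv/= lte_fin -EFinB subr0.
  by move: c0; rewrite lee_fin; case: ltgtP => // <-.
rewrite (_ : mkset _ = [set` `]0, +oo[ ]); last first.
  by apply/seteqP; split => r /=; rewrite in_itv/= ltry.
by rewrite meas lebesgue_measure_itv/= ltry.
Qed.

(** Layer cake reduces u to the indicators of its superlevel sets, where [muE] applies, and Tonelli
    moves the level variable back inside. The map [Phi] allows one statement to cover both joint
    laws (identity) and the law of the next x (second projection). *)
Lemma integral_kernel_density (u : U -> \bar R) : measurable_fun setT u ->
  (forall x, 0 <= u x)%E ->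
  (\int[mu]_x u x = \int[ls]_s \int[lt]_t (u (Phi (s, t)) * (k (s, t))%:E))%E.
Proof.
move=> mu' u0.
pose E : set (U * mR) := [set p | ((0 : R) < p.2) && ((p.2 : R)%:E < u p.1)%E].
have mE : measurable E.
  apply: measurable_setE; apply: measurable_and.
    by apply: measurable_fun_ltr => //; exact: measurable_snd.
  apply: measurable_fun_lte; first by apply/measurable_EFinP; exact: measurable_snd.
  exact: measurableT_comp.
have iE : measurable_fun setT (fun p => (\1_E p : R)) by exact: measurable_indic.
have layer x : u x = (\int[leb]_r (\1_E (x, r))%:E)%E.
  by rewrite -[LHS]layer_cake.
transitivity (\int[mu]_x \int[leb]_r (\1_E (x, r))%:E)%E.
  by apply: eq_integral => x _; exact: layer.
rewrite (fubini_tonelli (fun p => (\1_E p)%:E))//; last exact/measurable_EFinP.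
pose W (q : (mR * S) * T) : R := \1_E (Phi (q.1.2, q.2), q.1.1) * k (q.1.2, q.2).
have mst : measurable_fun [set: (mR * S) * T] (fun q => (q.1.2, q.2)).
  apply: measurable_fun_pair => //; exact: (measurableT_comp measurable_snd measurable_fst).
have mW : measurable_fun setT W.
  apply: measurable_funM; last exact: measurableT_comp.
  apply: (measurableT_comp iE); apply: measurable_fun_pair.
    exact: measurableT_comp.
  exact: (measurableT_comp measurable_fst measurable_fst).
have W0 q : 0 <= W q by rewrite mulr_ge0.
transitivity (\int[leb]_r \int[ls]_s \int[lt]_t (W (r, s, t))%:E)%E.
  apply: eq_integral => r _.
  have mS : measurable [set x | E (x, r)].
    by rewrite -[X in measurable X]setTI; exact: (pair2_measurable r).
  transitivity (mu [set x | E (x, r)]); last by rewrite muE.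
  rewrite (eq_integral (fun x => (\1_[set x | E (x, r)] x : R)%:E)).
    by rewrite integral_indic// setIT.
  by move=> x _; rewrite !indicE; congr (_%:R%:E); congr nat_of_bool.
have mW' : measurable_fun setT (fun q => \int[lt]_t (W (q, t))%:E)%E.
  apply: (measurable_fun_fubini_tonelli_F (fun q => (W q)%:E)) => //.
  exact/measurable_EFinP.
rewrite (fubini_tonelli (fun q : mR * S => \int[lt]_t (W (q, t))%:E)%E)//; last first.
  by move=> q; apply: integral_ge0 => t _; rewrite lee_fin.
apply: eq_integral => s _.
have mWs : measurable_fun setT (fun q : mR * T => (W (q.1, s, q.2))%:E).
  apply/measurable_EFinP; apply: (measurableT_comp mW).
  apply: measurable_fun_pair => //; exact: (measurableT_comp (pair2_measurable s)).
rewrite (fubini_tonelli (fun q : mR * T => (W (q.1, s, q.2))%:E))//; last first.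
  by move=> q; rewrite lee_fin.
apply: eq_integral => t _.
rewrite layer -ge0_integralZr ?lee_fin//.
by apply/measurable_EFinP; exact: (measurableT_comp iE (pair1_measurable (Phi (s, t)))).
Qed.

End Extension.

Section KernelMeasurable.
Variables (R : realType) (d : nat) (h : d.-tuple R -> R) (eta : R).
Hypothesis eta0 : 0 < eta.
Hypothesis ch : convex_fun h.
Local Notation m := (lebRd R d).
Local Notation gdens := (gdens h eta).
Local Notation gZ := (gZ h eta).
Local Notation gmean := (gmean h eta).

Lemma measurable_gint (u : d.-tuple R -> R) : measurable_fun setT u ->
  (forall z, 0 <= u z) ->
  measurable_fun setT (fun c => \int[m]_z (u z * gdens c z)).
Proof.
move=> mu u0; apply: measurableT_comp => //.
apply: (measurable_fun_fubini_tonelli_F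
  (fun p : d.-tuple R * d.-tuple R => (u p.2 * gdens p.1 p.2)%:E)) => //.
  apply/measurable_EFinP; apply: measurable_funM; last exact: measurable_gdens2.
  exact: measurableT_comp.
by move=> p; rewrite lee_fin mulr_ge0// gdens_ge0.
Qed.

Lemma measurable_gZ : measurable_fun setT gZ.
Proof.
have -> : gZ = fun c => \int[m]_z (1 * gdens c z).
  by apply/funext => c; apply: eq_Rintegral => z _; rewrite mul1r.
exact: measurable_gint.
Qed.

Lemma measurable_gZV : measurable_fun setT (fun c => (gZ c)^-1).
Proof.
have -> : (fun c => (gZ c)^-1) = fun c => expR (- ln (gZ c)).
  by apply/funext => c; rewrite expRN lnK// posrE gZ_gt0.
apply: measurableT_comp => //; apply: measurableT_comp => //.
by apply: measurableT_comp measurable_gZ; exact: measurable_ln.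
Qed.

Lemma measurable_gmean (u : d.-tuple R -> R) : measurable_fun setT u ->
  (forall z, 0 <= u z) -> measurable_fun setT (gmean ^~ u).
Proof.
move=> mu u0; apply: measurable_funM; last exact: measurable_gZV.
exact: measurable_gint.
Qed.

Lemma gmean_itv (u : d.-tuple R -> R) a b c : measurable_fun setT u ->
  (forall z, a <= u z <= b) -> a <= gmean c u <= b.
Proof.
move=> mu uab.
have iu : gint h eta c u.
  apply: (@gint_bounded _ _ _ _ eta0 ch _ _ (Num.max `|a| `|b|)) => // z.
  by have /andP[? ?] := uab z; rewrite le_max !ler_normr !ler_norml; lra.
apply/andP; split.
- rewrite -[leLHS](gmean_cst eta0 ch c); apply: le_gmean => //.
    exact: gint_cst.
  by move=> z; have /andP[] := uab z.
- rewrite -[leRHS](gmean_cst eta0 ch c); apply: le_gmean => //.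
    exact: gint_cst.
  by move=> z; have /andP[] := uab z.
Qed.

Definition kdens c z := gdens c z / gZ c.

Lemma kdens_ge0 c z : 0 <= kdens c z.
Proof. by rewrite mulr_ge0 ?gdens_ge0// invr_ge0 ltW// gZ_gt0. Qed.

Lemma measurable_kdens2 :
  measurable_fun setT (fun p : d.-tuple R * d.-tuple R => kdens p.1 p.2).
Proof.
apply: measurable_funM; first exact: measurable_gdens2.
by apply: measurableT_comp measurable_gZV _.
Qed.

Lemma cond_intE c (v : d.-tuple R -> R) : measurable_fun setT v ->
  (forall z, 0 <= v z) ->
  cond_int h eta c (fun z => (v z)%:E) = (\int[m]_z (v z * kdens c z)%:E)%E.
Proof.
move=> mv v0.
have mg : measurable_fun setT (gdens c) by exact: measurable_gdens.
have mvg : measurable_fun setT (fun z => (v z * gdens c z)%:E).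
  exact/measurable_EFinP/measurable_funM.
have e1 : lebRd_int (fun z => (v z)%:E * (gdens c z)%:E)%E =
    (\int[m]_z (v z * gdens c z)%:E)%E.
  by apply: lebRd_intE => // z; rewrite lee_fin mulr_ge0// gdens_ge0.
have e2 : lebRd_int (fun z => (gdens c z)%:E) = (\int[m]_z (gdens c z)%:E)%E.
  by apply: lebRd_intE => [|z]; [exact/measurable_EFinP|rewrite lee_fin gdens_ge0].
rewrite /cond_int e1 e2.
rewrite -[fine _]/(gZ c).
rewrite -ge0_integralZr//; last 2 first.
- by move=> z _; rewrite lee_fin mulr_ge0// gdens_ge0.
- by rewrite lee_fin invr_ge0 ltW// gZ_gt0.
by apply: eq_integral => z _; rewrite -!EFinM mulrA.
Qed.

Lemma integral_kdens c (u : d.-tuple R -> R) : gint h eta c u ->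
  (\int[m]_z (u z * kdens c z)%:E = (gmean c u)%:E)%E.
Proof.
move=> iu.
rewrite (eq_integral (fun z => (gZ c)^-1%:E * (u z * gdens c z)%:E)%E); last first.
  by move=> z _; rewrite -EFinM; congr EFin; rewrite /kdens; ring.
rewrite integralZl// -EFin_gmean// -EFinM; congr EFin.
by rewrite mulrCA mulVf ?mulr1 ?gt_eqF ?gZ_gt0.
Qed.

End KernelMeasurable.

(** * The Gibbs sampler *)

Section Gibbs.
Variables (R : realType) (d : nat) (eta : R) (f g : d.-tuple R -> R) (z0 : R).
Local Notation T := (d.-tuple R).
Variables (pi : probability (T * T)%type R) (nu : nat -> probability T R)
  (mu : nat -> probability (T * T)%type R).
Hypotheses (eta0 : 0 < eta) (cf : convex_fun f) (cg : convex_fun g) (z00 : 0 < z0).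
Local Notation m := (lebRd R d).
Hypothesis piE : forall A, measurable A -> pi A =
  (\int[m]_x \int[m]_y (\1_A (x, y) * (joint_dens f g eta x y / z0))%:E)%E.
Hypothesis muE : forall k A, measurable A ->
  mu k A = (\int[nu k]_x cond_int g eta x (fun y => (\1_A (x, y))%:E))%E.
Hypothesis nuE : forall k B, measurable B ->
  nu k.+1 B = (\int[mu k]_p cond_int f eta p.2 (fun x => (\1_B x)%:E))%E.
Implicit Types (u : T -> R) (k : nat).

Let mf := convex_measurable cf.

(** The disintegration of pi along x; [joint_densE2] is the one along y. Each gives one half of the
    invariance of pi. *)
Lemma joint_densE1 x y : joint_dens f g eta x y = expR (- f x) * gdens g eta x y.
Proof. by rewrite -expRD; congr expR; ring. Qed.

Lemma dist2C (x y : T) : dist2 x y = dist2 y x.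
Proof. by apply: eq_bigr => i _; rewrite -sqrrN opprB. Qed.

Lemma joint_densE2 x y : joint_dens f g eta x y = expR (- g y) * gdens f eta y x.
Proof. by rewrite -expRD (dist2C y x); congr expR; ring. Qed.

Lemma joint_dens_ge0 x y : 0 <= joint_dens f g eta x y.
Proof. exact: expR_ge0. Qed.

Lemma measurable_joint : measurable_fun setT
  (fun p : T * T => joint_dens f g eta p.1 p.2).
Proof.
have -> : (fun p : T * T => joint_dens f g eta p.1 p.2) =
    (fun p => expR (- f p.1) * gdens g eta p.1 p.2).
  by apply/funext => p; exact: joint_densE1.
apply: measurable_funM; last exact: measurable_gdens2.
apply: measurableT_comp => //; apply: measurableT_comp => //.
exact: measurableT_comp.
Qed.

Lemma integral_pi (w : T * T -> \bar R) : measurable_fun setT w ->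
  (forall p, 0 <= w p)%E ->
  (\int[pi]_p w p =
   \int[m]_x \int[m]_y (w (x, y) * (joint_dens f g eta x y / z0)%:E))%E.
Proof.
move=> mw w0.
apply: (@integral_kernel_density _ _ _ _ _ _ _ m m pi
  (fun p => joint_dens f g eta p.1 p.2 / z0) id) => //.
- by apply: measurable_funM => //; exact: measurable_joint.
- by move=> p; rewrite mulr_ge0 ?joint_dens_ge0// invr_ge0 ltW.
Qed.

Lemma integral_mu k (w : T * T -> \bar R) : measurable_fun setT w ->
  (forall p, 0 <= w p)%E ->
  (\int[mu k]_p w p =
   \int[nu k]_x \int[m]_y (w (x, y) * (kdens g eta x y)%:E))%E.
Proof.
move=> mw w0.
apply: (@integral_kernel_density _ _ _ _ _ _ _ (nu k) m (mu k)
  (fun p => kdens g eta p.1 p.2) id) => //.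
- exact: measurable_kdens2.
- by move=> p; exact: kdens_ge0.
move=> A mA; rewrite muE//; apply: eq_integral => x _.
apply: cond_intE => //.
have mi : measurable_fun setT (\1_A : T * T -> R) by exact: measurable_indic.
exact: (measurableT_comp mi (pair1_measurable x)).
Qed.

Lemma integral_nuS k (w : T -> \bar R) : measurable_fun setT w ->
  (forall x, 0 <= w x)%E ->
  (\int[nu k.+1]_x w x =
   \int[mu k]_p \int[m]_x (w x * (kdens f eta p.2 x)%:E))%E.
Proof.
move=> mw w0.
apply: (@integral_kernel_density _ _ _ _ _ _ _ (mu k) m (nu k.+1)
  (fun q : (T * T) * T => kdens f eta q.1.2 q.2) snd) => //.
- have mq : measurable_fun [set: (T * T) * T] (fun q => (q.1.2, q.2)).
    apply: measurable_fun_pair => //.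
    exact: (measurableT_comp measurable_snd measurable_fst).
  exact: (measurableT_comp (measurable_kdens2 eta0 cf) mq).
- by move=> p; exact: kdens_ge0.
move=> B mB; rewrite nuE//; apply: eq_integral => p _.
by apply: cond_intE => //; exact: measurable_indic.
Qed.

(** The Markov operator P of one full step: conditional expectation of u at the next x, given the
    current x. On functions the last draw is integrated first. *)
Definition gibbs u x := gmean g eta x (fun y => gmean f eta y u).

Definition bm u (a b : R) := measurable_fun setT u /\ forall z, a <= u z <= b.

Lemma bm_gmean (h : T -> R) u a b : convex_fun h -> 0 <= a -> bm u a b ->
  bm (fun c => gmean h eta c u) a b.
Proof.
move=> ch a0 [mu' uab]; split; last by move=> z; exact: gmean_itv.
apply: measurable_gmean => // z; have /andP[au _] := uab z; exact: le_trans au.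
Qed.

Lemma bm_gint (h : T -> R) u a b c : convex_fun h -> 0 <= a -> bm u a b ->
  gint h eta c u.
Proof.
move=> ch a0 [mu' uab]; apply: (@gint_bounded _ _ _ _ eta0 ch _ _ b) => // z.
by have /andP[au ub] := uab z; rewrite ger0_norm// (le_trans a0).
Qed.

Lemma bm_gibbs u a b : 0 <= a -> bm u a b -> bm (gibbs u) a b.
Proof. by move=> a0 bu; apply: bm_gmean => //; exact: bm_gmean. Qed.

Lemma bm_iter_gibbs k u a b : 0 <= a -> bm u a b -> bm (iter k gibbs u) a b.
Proof. by move=> a0 bu; elim: k => //= k IH; exact: bm_gibbs. Qed.

Lemma integral_kdensE (h : T -> R) u a b c : convex_fun h -> 0 <= a -> bm u a b ->
  (\int[m]_z ((u z)%:E * (kdens h eta c z)%:E) = (gmean h eta c u)%:E)%E.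
Proof. by move=> ch a0 bu; rewrite -integral_kdens//; exact: bm_gint bu. Qed.

Lemma integral_nu_gibbs k u b : bm u 0 b ->
  (\int[nu k.+1]_x (u x)%:E = \int[nu k]_x (gibbs u x)%:E)%E.
Proof.
move=> bu; have [mu' ub] := bu.
rewrite integral_nuS; last 2 first.
- exact/measurable_EFinP.
- by move=> x; have /andP[] := ub x; rewrite lee_fin.
rewrite (eq_integral (fun p : T * T => (gmean f eta p.2 u)%:E)); last first.
  by move=> p _; rewrite (integral_kdensE _ _ _ bu).
have [mw wb] := bm_gmean cf (lexx 0) bu.
rewrite integral_mu; last 2 first.
- by apply/measurable_EFinP; exact: (measurableT_comp mw).
- by move=> p; have /andP[] := wb p.2; rewrite lee_fin.
by apply: eq_integral => x _; rewrite (integral_kdensE _ _ _ (bm_gmean cf (lexx 0) bu)).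
Qed.

Lemma integral_nu_iter k u b : bm u 0 b ->
  (\int[nu k]_x (u x)%:E = \int[nu 0%N]_x (iter k gibbs u x)%:E)%E.
Proof.
elim: k u => [//|k IH] u bu.
by rewrite (integral_nu_gibbs _ bu) IH ?iterSr//; exact: bm_gibbs.
Qed.

(** For each x both inner integrals equal e(x) Z(x) Q_x u: this is the tower property for a joint
    density e(x) [gdens h eta x y]. *)
Lemma integral_weighted_kernel (h : T -> R) (e : T -> R) u b : convex_fun h ->
  (forall x, 0 <= e x) -> bm u 0 b ->
  (\int[m]_x \int[m]_y ((gmean h eta x u)%:E * (e x * gdens h eta x y)%:E) =
   \int[m]_x \int[m]_y ((u y)%:E * (e x * gdens h eta x y)%:E))%E.
Proof.
move=> ch e0 bu; apply: eq_integral => x _; have [mu' ub] := bu.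
have [_ qb] := bm_gmean ch (lexx 0) bu.
have q0 : 0 <= gmean h eta x u by have /andP[] := qb x.
have mG := measurable_gdens eta ch x.
have u0 z : 0 <= u z by have /andP[] := ub z.
have G0 z : (0 <= (gdens h eta x z)%:E)%E by rewrite lee_fin gdens_ge0.
rewrite (eq_integral (fun y =>
    (gmean h eta x u * e x)%:E * (gdens h eta x y)%:E)%E); last first.
  by move=> y _; rewrite -!EFinM mulrA.
rewrite [RHS](eq_integral (fun y => (e x)%:E * (u y * gdens h eta x y)%:E)%E); last first.
  by move=> y _; rewrite -!EFinM mulrCA.
have mGE : measurable_fun setT (fun y => (gdens h eta x y)%:E) by exact/measurable_EFinP.
have muG : measurable_fun setT (fun y => (u y * gdens h eta x y)%:E).
  by apply/measurable_EFinP; exact: measurable_funM.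
have uG0 y : (0 <= (u y * gdens h eta x y)%:E)%E.
  by rewrite lee_fin mulr_ge0// gdens_ge0.
have c0 : (0 <= (gmean h eta x u * e x)%:E)%E by rewrite lee_fin mulr_ge0.
have ex0 : (0 <= (e x)%:E)%E by rewrite lee_fin.
rewrite ge0_integralZl// ge0_integralZl//.
rewrite -EFin_gmean//; last exact: bm_gint bu.
by rewrite -EFin_gZ// -!EFinM -mulrA mulrCA.
Qed.

(** Invariance of pi by two uses of the tower property, conditioning first on x and then on y; the
    second needs the order of integration exchanged. *)
Lemma integral_pi_gibbs u b : bm u 0 b ->
  (\int[pi]_p (gibbs u p.1)%:E = \int[pi]_p (u p.1)%:E)%E.
Proof.
move=> bu; have [mu' ub] := bu.
have bw := bm_gmean cf (lexx 0) bu; have [mw wb] := bw.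
have [mq qb] := bm_gmean cg (lexx 0) bw.
have pos c (w : T -> R) : bm w 0 c -> forall x, (0 <= (w x)%:E)%E.
  by move=> [_ h] x; have /andP[] := h x; rewrite lee_fin.
have zV0 : 0 <= z0^-1 by rewrite invr_ge0 ltW.
have m1 : measurable_fun setT (fun p : T * T => (gibbs u p.1)%:E).
  by apply/measurable_EFinP; exact: (measurableT_comp mq).
have m2 : measurable_fun setT (fun p : T * T => (gmean f eta p.2 u)%:E).
  by apply/measurable_EFinP; exact: (measurableT_comp mw).
have m3 : measurable_fun setT (fun p : T * T => (u p.1)%:E).
  by apply/measurable_EFinP; exact: (measurableT_comp mu').
have p1 (p : T * T) : (0 <= (gibbs u p.1)%:E)%E.
  exact: pos (bm_gmean cg (lexx 0) bw) _.
have p2 (p : T * T) : (0 <= (gmean f eta p.2 u)%:E)%E by exact: pos bw _.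
have p3 (p : T * T) : (0 <= (u p.1)%:E)%E by exact: pos bu _.
transitivity (\int[pi]_p (gmean f eta p.2 u)%:E)%E.
  apply: (etrans (integral_pi m1 p1)); apply: (etrans _ (esym (integral_pi m2 p2))).
  have E x y : joint_dens f g eta x y / z0 = expR (- f x) / z0 * gdens g eta x y.
    by rewrite joint_densE1 mulrAC.
  have R1 (w : T -> T -> \bar R) :
      (\int[m]_x \int[m]_y (w x y * (joint_dens f g eta x y / z0)%:E) =
       \int[m]_x \int[m]_y (w x y * (expR (- f x) / z0 * gdens g eta x y)%:E))%E.
    by apply: eq_integral => x _; apply: eq_integral => y _; rewrite E.
  apply: etrans (R1 (fun x _ => (gibbs u x)%:E)) _.
  apply: etrans (esym (R1 (fun _ y => (gmean f eta y u)%:E))).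
  apply: (@integral_weighted_kernel g (fun x => expR (- f x) / z0) _ b) => // x.
  by rewrite mulr_ge0 ?expR_ge0.
apply: (etrans (integral_pi m2 p2)); apply: (etrans _ (esym (integral_pi m3 p3))).
have E x y : joint_dens f g eta x y / z0 = expR (- g y) / z0 * gdens f eta y x.
  by rewrite joint_densE2 mulrAC.
have mJ : measurable_fun setT (fun p : T * T => (joint_dens f g eta p.1 p.2 / z0)%:E).
  by apply/measurable_EFinP; apply: measurable_funM => //; exact: measurable_joint.
have J0 p : (0 <= (joint_dens f g eta p.1 p.2 / z0)%:E)%E.
  by rewrite lee_fin mulr_ge0// joint_dens_ge0.
have F (w : T * T -> \bar R) : measurable_fun setT w -> (forall p, 0 <= w p)%E ->
    (\int[m]_x \int[m]_y (w (x, y) * (joint_dens f g eta x y / z0)%:E) =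
     \int[m]_y \int[m]_x (w (x, y) * (joint_dens f g eta x y / z0)%:E))%E.
  move=> mw' w0; apply: (fubini_tonelli (fun p : T * T =>
    w p * (joint_dens f g eta p.1 p.2 / z0)%:E)%E).
    exact: emeasurable_funM.
  by move=> p; rewrite mule_ge0.
apply: (etrans (F _ m2 p2)); apply: (etrans _ (esym (F _ m3 p3))).
have R1 (w : T -> T -> \bar R) :
    (\int[m]_y \int[m]_x (w x y * (joint_dens f g eta x y / z0)%:E) =
     \int[m]_y \int[m]_x (w x y * (expR (- g y) / z0 * gdens f eta y x)%:E))%E.
  by apply: eq_integral => y _; apply: eq_integral => x _; rewrite E.
apply: etrans (R1 (fun _ y => (gmean f eta y u)%:E)) _.
apply: etrans (esym (R1 (fun x _ => (u x)%:E))).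
apply: (@integral_weighted_kernel f (fun y => expR (- g y) / z0) _ b) => // x.
by rewrite mulr_ge0 ?expR_ge0.
Qed.

Lemma integral_pi_iter k u b : bm u 0 b ->
  (\int[pi]_p (iter k gibbs u p.1)%:E = \int[pi]_p (u p.1)%:E)%E.
Proof.
elim: k u => [//|k IH] u bu.
by rewrite iterSr IH ?(integral_pi_gibbs bu)//; exact: bm_gibbs.
Qed.

(** The innermost f-kernel gives n = 1 by [harnack0]; every further kernel raises n by one through
    [harnack_step], alternately for g and f, ending at n = 2 (k + 1) after k + 1 full steps. *)
Lemma gibbs_harnack k u B : bm u 0 B -> forall x y,
  iter k.+1 gibbs u x <= ln (iter k.+1 gibbs (fun z => expR (u z)) y) +
    dist2 x y / (2 * eta * (k.+1).*2%:R).
Proof.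
move=> bu; have [mu' ub] := bu.
have be : bm (fun z => expR (u z)) 1 (expR B).
  split; first exact: measurableT_comp.
  by move=> z; have /andP[u0 uB] := ub z; rewrite -[1]expR0 !ler_expR u0 uB.
have step1 z z' : gmean f eta z u <= ln (gmean f eta z' (fun t => expR (u t))) +
    dist2 z z' / (2 * eta * 1%:R).
  rewrite mulr1; apply: (harnack0 eta0 cf z z' mu' (B := B)) => w.
  by have /andP[u0 uB] := ub w; rewrite ger0_norm.
elim: k => [|k IH] x y.
  have [mF bF] := bm_gmean cf (lexx 0) bu.
  have [mP bP] := bm_gmean cf ler01 be.
  exact: (harnack_step eta0 cg x y (ltn0Sn 0) mF mP bF bP step1).
have bF1 := bm_iter_gibbs k.+1 (lexx 0) bu; have [mF1 F1b] := bF1.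
have bP1 := bm_iter_gibbs k.+1 ler01 be; have [mP1 P1b] := bP1.
have [mF bF] := bm_gmean cf (lexx 0) bF1.
have [mP bP] := bm_gmean cf ler01 bP1.
have step2 z z' := harnack_step eta0 cf z z' (ltn0Sn _) mF1 mP1 F1b P1b IH.
exact: (harnack_step eta0 cg x y (ltn0Sn _) mF mP bF bP step2).
Qed.

End Gibbs.

Lemma probability_integral_cst (R : realType) (d : measure_display)
    (S : measurableType d) (P : probability S R) (c : R) :
  (\int[P]_x c%:E = c%:E)%E.
Proof.
rewrite integral_cst//; apply: (etrans _ (mule1 _)); congr (_ * _)%E.
exact: probability_setT.
Qed.

Lemma integral_marginal (R : realType) (d1 d2 : measure_display)
    (S : measurableType d1) (U : measurableType d2)
    (P : probability S R) (Q : probability U R) (phi : S -> U)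
    (u : U -> \bar R) : measurable_fun setT phi ->
  (forall A, measurable A -> Q A = P (phi @^-1` A)) ->
  measurable_fun setT u -> (forall x, 0 <= u x)%E ->
  (\int[Q]_x u x = \int[P]_s u (phi s))%E.
Proof.
move=> mphi QE mu u0.
pose mP : {measure set U -> \bar R} :=
  measure_function_pushforward__canonical__measure_function_Measure P mphi.
transitivity (\int[mP]_x u x)%E.
  by apply: eq_measure_integral => A mA _; exact: QE.
have := @ge0_integral_pushforward _ _ _ _ R _ mphi P setT u measurableT mu.
by rewrite preimage_setT; apply => y _; exact: u0.
Qed.

(** * Integrating the Harnack inequality over a coupling of the initial law and the X-marginal of
    pi *)

Section Transport.
Variables (R : realType) (d : nat) (eta : R) (f g : d.-tuple R -> R) (z0 : R).
Local Notation T := (d.-tuple R).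
Variables (pi : probability (T * T)%type R) (nu : nat -> probability T R)
  (mu : nat -> probability (T * T)%type R).
Hypotheses (eta0 : 0 < eta) (cf : convex_fun f) (cg : convex_fun g) (z00 : 0 < z0).
Local Notation m := (lebRd R d).
Hypothesis piE : forall A, measurable A -> pi A =
  (\int[m]_x \int[m]_y (\1_A (x, y) * (joint_dens f g eta x y / z0))%:E)%E.
Hypothesis muE : forall k A, measurable A ->
  mu k A = (\int[nu k]_x cond_int g eta x (fun y => (\1_A (x, y))%:E))%E.
Hypothesis nuE : forall k B, measurable B ->
  nu k.+1 B = (\int[mu k]_p cond_int f eta p.2 (fun x => (\1_B x)%:E))%E.
Local Notation gibbs := (gibbs eta f g).

Lemma transport_bound (k : nat) (gam : probability (T * T)%type R) (u : T -> R) B :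
  is_coupling (nu 0%N) (marginalX pi) gam -> bm u 0 B ->
  (\int[nu k.+1]_x (u x)%:E <=
   (ln (fine (\int[pi]_p (expR (u p.1))%:E)))%:E +
   ((2 * eta * (k.+1).*2%:R)^-1)%:E * \int[gam]_p (dist2 p.1 p.2)%:E)%E.
Proof.
move=> cpl bu; have [mu' ub] := bu.
pose phi z := expR (u z).
have be : bm phi 1 (expR B).
  split; first exact: measurableT_comp.
  by move=> z; have /andP[u0 uB] := ub z; rewrite -[1]expR0 !ler_expR u0 uB.
have be0 : bm phi 0 (expR B).
  by split; [exact: be.1|move=> z; rewrite expR_ge0; have /andP[] := be.2 z].
have [mF bF] := bm_iter_gibbs eta0 cf cg k.+1 (lexx 0) bu.
have [mP bP] := bm_iter_gibbs eta0 cf cg k.+1 ler01 be.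
set F := iter k.+1 gibbs u in mF bF *; set psi := iter k.+1 gibbs phi in mP bP *.
have psi1 z : 1 <= psi z by have /andP[] := bP z.
have psi0 z : 0 < psi z by exact: lt_le_trans ltr01 (psi1 z).
set a := fine _.
have mphi1 : measurable_fun setT (fun p : T * T => (phi p.1)%:E).
  by apply/measurable_EFinP; exact: (measurableT_comp be.1).
have Ephi : (\int[pi]_p (phi p.1)%:E = a%:E)%E.
  rewrite /a fineK// ge0_fin_numE; last first.
    by apply: integral_ge0 => p _; rewrite lee_fin expR_ge0.
  apply: (@le_lt_trans _ _ (\int[pi]_p (expR B)%:E)%E).
    apply: ge0_le_integral => //.
    by move=> p _; rewrite lee_fin; have /andP[] := be.2 p.1.
  by rewrite probability_integral_cst ltry.
have a1 : 1 <= a.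
  rewrite -lee_fin -Ephi -(probability_integral_cst pi 1).
  apply: ge0_le_integral => //.
  by move=> p _; rewrite lee_fin; have /andP[] := be.2 p.1.
have a0 : 0 < a by exact: lt_le_trans ltr01 a1.
have F0 z : (0 <= (F z)%:E)%E by rewrite lee_fin; have /andP[] := bF z.
have E1 : (\int[nu k.+1]_x (u x)%:E = \int[gam]_p (F p.1)%:E)%E.
  rewrite (integral_nu_iter eta0 cf cg muE nuE k.+1 bu).
  have mFE : measurable_fun setT (fun z => (F z)%:E).
    by apply/measurable_EFinP; exact: mF.
  apply: (integral_marginal measurable_fst _ mFE F0).
  move=> A mA; have [<- _] := cpl A mA; congr (gam _).
  by apply/seteqP; split => p /=; [case|].
(* The second marginal of the coupling is the X-marginal of pi, under which the iterates of the
   Gibbs operator keep the integral of e^u. *)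
have E2 : (\int[gam]_p (psi p.2)%:E = a%:E)%E.
  rewrite -Ephi -(integral_pi_iter eta0 cf cg z00 piE k.+1 be0) -/psi.
  pose piX : {measure set T -> \bar R} :=
    measure_function_pushforward__canonical__measure_function_Measure
      pi (@measurable_fst _ _ T T).
  pose gamX : {measure set T -> \bar R} :=
    measure_function_pushforward__canonical__measure_function_Measure
      gam (@measurable_snd _ _ T T).
  have mpsi : measurable_fun setT (fun z => (psi z)%:E) by exact/measurable_EFinP.
  have pos : {in [set: T], forall z, (0 <= (psi z)%:E)%E}.
    by move=> z _; rewrite lee_fin ltW.
  have G1 := @ge0_integral_pushforward _ _ _ _ R _ (@measurable_fst _ _ T T) pi
    setT _ measurableT mpsi pos.
  have G2 := @ge0_integral_pushforward _ _ _ _ R _ (@measurable_snd _ _ T T) gam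
    setT _ measurableT mpsi pos.
  rewrite preimage_setT in G1; rewrite preimage_setT in G2.
  apply: (etrans (esym G2)); apply: (etrans _ G1).
  apply: (@eq_measure_integral _ _ _ setT piX gamX) => A mA _.
  have [_ h] := cpl A mA.
  transitivity (gam (setT `*` A)).
    by congr (gam _); apply/seteqP; split => p /=; [|case].
  rewrite h; congr (pi _); apply/seteqP; split => p /=; [by case|by []].
have mlnpsi : measurable_fun setT (fun p : T * T => (ln (psi p.2))%:E).
  apply/measurable_EFinP.
  exact: (measurableT_comp (@measurable_ln R) (measurableT_comp mP measurable_snd)).
have lnpsi0 p : (0 <= (ln (psi p.2))%:E)%E by rewrite lee_fin ln_ge0.
have mdist : measurable_fun setT (fun p : T * T => (dist2 p.1 p.2)%:E).
  by apply/measurable_EFinP; exact: measurable_dist2.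
have dist0 (p : T * T) : (0 <= (dist2 p.1 p.2)%:E)%E by rewrite lee_fin dist2_ge0.
set c := (2 * eta * (k.+1).*2%:R)^-1.
have c0 : (0 <= c%:E)%E.
  by rewrite lee_fin invr_ge0 !mulr_ge0// ltW.
have mpsi2 : measurable_fun setT (fun p : T * T => (psi p.2)%:E).
  by apply/measurable_EFinP; exact: (measurableT_comp mP).
have psi2_ge0 (p : T * T) : (0 <= (psi p.2)%:E)%E by rewrite lee_fin ltW.
have aV0 : (0 <= a^-1%:E)%E by rewrite lee_fin invr_ge0 ltW.
have mapsi : measurable_fun setT (fun p : T * T => a^-1%:E * (psi p.2)%:E)%E.
  exact: measurable_funeM.
have apsi0 (p : T * T) : (0 <= a^-1%:E * (psi p.2)%:E)%E by exact: mule_ge0.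
(* Jensen through the tangent of ln at the mean: ln psi <= psi / a - 1 + ln a. The 1 is moved to the
   left so that all integrands are nonnegative. *)
have lnbound : (\int[gam]_p (ln (psi p.2))%:E <= (ln a)%:E)%E.
  have H : (\int[gam]_p (ln (psi p.2))%:E + 1 <= (ln a)%:E + 1)%E.
    rewrite -[X in (_ + X <= _)%E](probability_integral_cst gam 1) -ge0_integralD//.
    apply: (@le_trans _ _ (\int[gam]_p (a^-1%:E * (psi p.2)%:E + (ln a)%:E))%E).
      apply: ge0_le_integral => //.
      - by move=> p _; rewrite adde_ge0.
      - exact: emeasurable_funD.
      - exact: emeasurable_funD.
      move=> p _; rewrite -EFinM -!EFinD lee_fin.
      have pa : 0 < a^-1 * psi p.2 by rewrite mulr_gt0// invr_gt0.
      have := expR_ge1Dx (ln (a^-1 * psi p.2)); rewrite lnK ?posrE//.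
      rewrite lnM ?posrE ?invr_gt0// lnV ?posrE// [- ln a + _]addrC.
      by rewrite addrA lerBlDr [1 + _]addrC -?addrA.
    rewrite ge0_integralD//; last by move=> p _; rewrite lee_fin ln_ge0.
    rewrite ge0_integralZl//.
    rewrite E2 probability_integral_cst -EFinM mulVf ?gt_eqF//.
    by rewrite addeC.
  by move: H; rewrite leeD2rE.
rewrite E1.
apply: (@le_trans _ _ (\int[gam]_p ((ln (psi p.2))%:E + c%:E * (dist2 p.1 p.2)%:E))%E).
  apply: ge0_le_integral.
  - exact: measurableT.
  - by move=> p _; exact: F0.
  - by apply/measurable_EFinP; exact: (measurableT_comp mF).
  - by apply: emeasurable_funD; [exact: mlnpsi|exact: measurable_funeM].
  move=> p _; rewrite -EFinM -EFinD lee_fin mulrC.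
  exact: (gibbs_harnack eta0 cf cg k bu).
rewrite ge0_integralD//; last 2 first.
- by move=> p _; rewrite mule_ge0.
- exact: measurable_funeM.
by rewrite ge0_integralZl//; exact: leeD.
Qed.

End Transport.

(** * The density of the k-th joint law with respect to pi, for k >= 1 *)

Section Density.
Variables (R : realType) (d : nat) (eta : R) (f g : d.-tuple R -> R) (z0 : R).
Local Notation T := (d.-tuple R).
Variables (pi : probability (T * T)%type R) (nu : nat -> probability T R)
  (mu : nat -> probability (T * T)%type R).
Hypotheses (eta0 : 0 < eta) (cf : convex_fun f) (cg : convex_fun g) (z00 : 0 < z0).
Local Notation m := (lebRd R d).
Hypothesis piE : forall A, measurable A -> pi A =
  (\int[m]_x \int[m]_y (\1_A (x, y) * (joint_dens f g eta x y / z0))%:E)%E.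
Hypothesis muE : forall k A, measurable A ->
  mu k A = (\int[nu k]_x cond_int g eta x (fun y => (\1_A (x, y))%:E))%E.
Hypothesis nuE : forall k B, measurable B ->
  nu k.+1 B = (\int[mu k]_p cond_int f eta p.2 (fun x => (\1_B x)%:E))%E.

Let mf := convex_measurable cf.

(** The f-kernel stripped of e^(- f x), a factor that does not depend on the previous state and will
    cancel against the same factor in pi. *)
Let s (p : T * T) x := expR (- (dist2 p.2 x / (2 * eta))) / gZ f eta p.2.

Let s_ge0 p x : 0 <= s p x.
Proof. by rewrite mulr_ge0 ?expR_ge0// invr_ge0 ltW// gZ_gt0. Qed.

Let ms : measurable_fun setT (fun q : (T * T) * T => s q.1 q.2).
Proof.
have m12 : measurable_fun [set: (T * T) * T] (fun q => q.1.2).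
  exact: (measurableT_comp measurable_snd measurable_fst).
apply: measurable_funM; last exact: (measurableT_comp (measurable_gZV eta0 cf) m12).
apply: measurableT_comp => //; apply: measurableT_comp => //.
apply: measurable_funM => //.
have mq : measurable_fun [set: (T * T) * T] (fun q => (q.1.2, q.2)).
  exact: measurable_fun_pair.
exact: (measurableT_comp (@measurable_dist2 R d) mq).
Qed.

Let kdensE (p : T * T) x : kdens f eta p.2 x = expR (- f x) * s p x.
Proof. by rewrite /kdens /gdens /s expRD mulrA. Qed.

Let rho k x := (\int[mu k]_p (s p x)%:E)%E.

Let rho_ge0 k x : (0 <= rho k x)%E.
Proof. by apply: integral_ge0 => p _; rewrite lee_fin s_ge0. Qed.

Let mrho k : measurable_fun setT (rho k).
Proof.
apply: (measurable_fun_fubini_tonelli_G (fun q : (T * T) * T => (s q.1 q.2)%:E)).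
  exact/measurable_EFinP.
by move=> q; rewrite lee_fin s_ge0.
Qed.

Let mexpf : measurable_fun setT (fun x => (expR (- f x))%:E).
Proof. by apply/measurable_EFinP; apply: measurableT_comp => //; exact: measurableT_comp. Qed.

Let expf_ge0 x : (0 <= (expR (- f x))%:E)%E.
Proof. by rewrite lee_fin expR_ge0. Qed.

Lemma integral_nuS_rho k (w : T -> \bar R) : measurable_fun setT w ->
  (forall x, 0 <= w x)%E ->
  (\int[nu k.+1]_x w x = \int[m]_x ((w x * (expR (- f x))%:E) * rho k x))%E.
Proof.
move=> mw w0; apply: (etrans (integral_nuS eta0 cf nuE k mw w0)).
have mE : measurable_fun setT (fun q : (T * T) * T => w q.2 * (kdens f eta q.1.2 q.2)%:E)%E.
  apply: emeasurable_funM; first exact: (measurableT_comp mw measurable_snd).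
  apply/measurable_EFinP.
  have mq : measurable_fun [set: (T * T) * T] (fun q => (q.1.2, q.2)).
    apply: measurable_fun_pair => //.
    exact: (measurableT_comp measurable_snd measurable_fst).
  exact: (measurableT_comp (measurable_kdens2 eta0 cf) mq).
apply: (etrans (fubini_tonelli _ mE _)).
  by move=> q; rewrite mule_ge0// lee_fin kdens_ge0.
apply: eq_integral => x _.
rewrite /rho -ge0_integralZl//.
- by apply: eq_integral => p _ /=; rewrite kdensE EFinM muleA.
- apply/measurable_EFinP; exact: (measurableT_comp ms (pair2_measurable x)).
- by move=> p _; rewrite lee_fin s_ge0.
- by rewrite mule_ge0.
Qed.

Definition nudens k x := fine (rho k x).

Let nudens_ge0 k x : 0 <= nudens k x. Proof. exact/fine_ge0/rho_ge0. Qed.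

Let mnudens k : measurable_fun setT (nudens k).
Proof. exact: measurableT_comp. Qed.

(** The function e^(- f) [rho] has integral 1, so [rho] is finite almost everywhere and can be
    replaced by its real version [nudens] without changing the integral. *)
Lemma integral_nuS_dens k (w : T -> \bar R) : measurable_fun setT w ->
  (forall x, 0 <= w x)%E ->
  (\int[nu k.+1]_x w x = \int[m]_x (w x * (expR (- f x) * nudens k x)%:E))%E.
Proof.
move=> mw w0; apply: (etrans (integral_nuS_rho k mw w0)).
have I1 : (\int[m]_x ((expR (- f x))%:E * rho k x) = 1)%E.
  have := probability_integral_cst (nu k.+1) 1.
  rewrite (integral_nuS_rho k (w := cst 1%E))//.
  by move=> <-; apply: eq_integral => x _; rewrite mul1e.
have mer : measurable_fun setT (fun x => (expR (- f x))%:E * rho k x)%E.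
  exact: emeasurable_funM.
have ier : m.-integrable setT (fun x => (expR (- f x))%:E * rho k x)%E.
  apply/integrableP; split => //.
  rewrite (eq_integral (fun x => (expR (- f x))%:E * rho k x)%E).
    by rewrite I1 ltry.
  by move=> x _; rewrite gee0_abs// mule_ge0.
have mnE : measurable_fun setT (fun x => (expR (- f x) * nudens k x)%:E).
  apply/measurable_EFinP; apply: measurable_funM => //.
  exact/measurable_EFinP.
apply: ge0_ae_eq_integral => //.
- by apply: emeasurable_funM => //; exact: emeasurable_funM.
- exact: emeasurable_funM.
- by move=> x _; rewrite !mule_ge0.
- by move=> x _; rewrite mule_ge0// lee_fin mulr_ge0// expR_ge0.
have := integrable_ae measurableT ier.
apply: filterS => x /(_ I) fin _; rewrite -muleA EFinM; congr (_ * (_ * _))%E.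
rewrite /nudens fineK//.
rewrite ge0_fin_numE// ltey; apply/eqP => rx; move: fin.
by rewrite rx mulry gtr0_sg ?expR_gt0// mul1e.
Qed.

(** Ratio of e^(- f) [nudens], the Lebesgue density of the law of the (k+1)-st x, to e^(- f) Z_g /
    z0, that of the X-marginal of pi. Both joint laws share the kernel of y given x, so it is also
    the ratio of the joint densities. *)
Definition pidens k x := nudens k x * z0 / gZ g eta x.

Lemma pidens_ge0 k x : 0 <= pidens k x.
Proof. by rewrite !mulr_ge0// ?invr_ge0 ltW// gZ_gt0. Qed.

Lemma measurable_pidens k : measurable_fun setT (pidens k).
Proof.
apply: measurable_funM; last exact: measurable_gZV.
exact: measurable_funM.
Qed.

Lemma integral_muS_dens k (w : T * T -> \bar R) : measurable_fun setT w ->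
  (forall p, 0 <= w p)%E ->
  (\int[mu k.+1]_p w p = \int[pi]_p (w p * (pidens k p.1)%:E))%E.
Proof.
move=> mw w0; apply: (etrans (integral_mu eta0 cg muE k.+1 mw w0)).
have mwk : measurable_fun setT (fun p : T * T => w p * (kdens g eta p.1 p.2)%:E)%E.
  by apply: emeasurable_funM => //; apply/measurable_EFinP; exact: measurable_kdens2.
have wk0 (p : T * T) : (0 <= w p * (kdens g eta p.1 p.2)%:E)%E.
  by rewrite mule_ge0// lee_fin kdens_ge0.
have mW : measurable_fun setT (fun x => \int[m]_y (w (x, y) * (kdens g eta x y)%:E))%E.
  exact: (measurable_fun_fubini_tonelli_F (fun p => w p * (kdens g eta p.1 p.2)%:E)%E).
have W0 x : (0 <= \int[m]_y (w (x, y) * (kdens g eta x y)%:E))%E.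
  by apply: integral_ge0 => y _; exact: (wk0 (x, y)).
apply: (etrans (integral_nuS_dens k mW W0)).
have mwq : measurable_fun setT (fun p : T * T => w p * (pidens k p.1)%:E)%E.
  apply: emeasurable_funM => //; apply/measurable_EFinP.
  exact: (measurableT_comp (measurable_pidens k) measurable_fst).
have wq0 (p : T * T) : (0 <= w p * (pidens k p.1)%:E)%E.
  by rewrite mule_ge0// lee_fin pidens_ge0.
apply: (etrans _ (esym (integral_pi cf cg z00 piE mwq wq0))).
apply: eq_integral => x _.
have mwx : measurable_fun setT (fun y => w (x, y) * (kdens g eta x y)%:E)%E.
  exact: (measurableT_comp mwk (pair1_measurable x)).
have wx0 y : (0 <= w (x, y) * (kdens g eta x y)%:E)%E by exact: (wk0 (x, y)).
have c0 : (0 <= (expR (- f x) * nudens k x)%:E)%E.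
  by rewrite lee_fin mulr_ge0// expR_ge0.
apply: (etrans (esym (@ge0_integralZr _ _ _ m setT measurableT _ mwx _
  (fun y _ => wx0 y) c0))).
apply: eq_integral => y _; rewrite -!muleA -!EFinM; congr (_ * _%:E)%E.
rewrite joint_densE1 /kdens /pidens.
have Zn : gZ g eta x != 0 by rewrite gt_eqF// gZ_gt0.
have zn : z0 != 0 by rewrite gt_eqF.
move: (gZ g eta x) (gdens g eta x y) (expR (- f x)) (nudens k x) Zn => A B C D An.
by field; rewrite zn An.
Qed.

Lemma integral_nuS_pidens k (u : T -> R) : measurable_fun setT u ->
  (forall x, 0 <= u x) ->
  (\int[nu k.+1]_x (u x)%:E = \int[pi]_p (u p.1 * pidens k p.1)%:E)%E.
Proof.
move=> mu' u0.
have muE' : measurable_fun setT (fun p : T * T => (u p.1)%:E).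
  by apply/measurable_EFinP; exact: (measurableT_comp mu').
have u0' (p : T * T) : (0 <= (u p.1)%:E)%E by rewrite lee_fin.
apply: (etrans _ (integral_muS_dens k muE' u0')).
apply: (etrans _ (esym (integral_mu eta0 cg muE k.+1 muE' u0'))).
apply: eq_integral => x _; rewrite /= ge0_integralZl ?lee_fin//; last 2 first.
- apply/measurable_EFinP.
  exact: (measurableT_comp (measurable_kdens2 eta0 cg) (pair1_measurable x)).
- by move=> y _; rewrite lee_fin kdens_ge0.
have := integral_kdens eta0 cg (gint_cst eta0 cg x 1).
rewrite gmean_cst// => I1.
rewrite (_ : (\int[m]_y (kdens g eta x y)%:E)%E = 1%:E) ?mule1//.
by rewrite -I1; apply: eq_integral => y _; rewrite mul1r.
Qed.

Lemma is_density_pidens k : is_density (mu k.+1) pi (fun p => pidens k p.1).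
Proof.
split.
- exact: (measurableT_comp (measurable_pidens k) measurable_fst).
- by move=> p; exact: pidens_ge0.
move=> A mA.
have mI : measurable_fun setT (fun p : T * T => (\1_A p : R)%:E).
  exact/measurable_EFinP/measurable_indic.
have -> : mu k.+1 A = (\int[mu k.+1]_p (\1_A p)%:E)%E by rewrite integral_indic// setIT.
rewrite (integral_muS_dens k mI)// [RHS]integral_mkcond.
apply: eq_integral => p _; rewrite patchE indicE.
by case: ifPn => _; rewrite ?mul1e ?mul0e.
Qed.

End Density.

(** * Entropy by truncation *)

Section Entropy.
Variables (R : realType) (dS : measure_display) (S : measurableType dS).
Variables (P : probability S R) (q : S -> R) (W : R).
Hypotheses (mq : measurable_fun setT q) (q0 : forall x, 0 <= q x).
Hypothesis q1 : (\int[P]_x (q x)%:E = 1)%E.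

Let tr (N y : R) := Num.min (Num.max y N^-1) N.

(** From ln (1 / y) <= 1 / y - 1 when y <= N. The added 1 makes the entropy integrand nonnegative,
    so that monotone convergence applies. *)
Lemma entropy_trunc_ge0 (N y : R) : 1 <= N -> 0 <= y -> 0 <= y * ln (Num.min y N) + 1.
Proof.
move=> N1 y0; have [yN|Ny] := leP y N; last first.
  by rewrite addr_ge0// mulr_ge0// ln_ge0.
have [->|yn0] := eqVneq y 0; first by rewrite mul0r add0r.
have yp : 0 < y by rewrite lt_def yn0.
have : - ln y <= y^-1 - 1.
  by rewrite -lnV ?posrE// lerBrDl (le_trans (expR_ge1Dx _))// lnK// posrE invr_gt0.
rewrite -(ler_pM2l yp) mulrBr mulfV// mulr1 mulrN; lra.
Qed.

Lemma trunc_gt0 (N y : R) : 0 < N -> 0 < tr N y.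
Proof. by move=> N0; rewrite /tr lt_min N0 andbT lt_max invr_gt0 N0 orbT. Qed.

Lemma trunc_itv (N y : R) : 1 <= N -> N^-1 <= tr N y <= N.
Proof.
move=> N1; rewrite /tr ge_min lexx orbT andbT le_min le_max lexx orbT/=.
by rewrite (le_trans _ N1)// invf_le1// (lt_le_trans ltr01).
Qed.

Lemma measurable_trunc N : measurable_fun setT (fun x => tr N (q x)).
Proof. by apply: measurable_minr => //; exact: measurable_maxr. Qed.

(** The variational bound for the test function ln [tr] + ln N, which takes values in [0, 2 ln N]:
    truncation on both sides makes it bounded and the shift makes it nonnegative. *)
Hypothesis trW : forall n : nat, let N : R := n.+1%:R in
  (\int[P]_x ((ln (tr N (q x)) + ln N) * q x)%:E <=
   (ln (fine (\int[P]_x (expR (ln (tr N (q x)) + ln N))%:E)) + W)%:E)%E.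

Let H n x := q x * ln (Num.min (q x) n.+1%:R) + 1.

Let H0 n x : 0 <= H n x.
Proof. by apply: entropy_trunc_ge0 => //; rewrite ler1n. Qed.

Let mH n : measurable_fun setT (H n).
Proof.
apply: measurable_funD => //; apply: measurable_funM => //.
by apply: measurableT_comp; [exact: measurable_ln|exact: measurable_minr].
Qed.

(** The shift adds ln N on the left, since q has mass 1, and at most ln N + 1 / N on the right,
    since [tr] <= q + 1 / N; so it costs only 1 / N. On the left the lower truncation only helps and
    is dropped. *)
Lemma entropy_trunc_le n : (\int[P]_x (H n x)%:E <= (W + 1 + n.+1%:R^-1)%:E)%E.
Proof.
set N : R := n.+1%:R.
have N1 : 1 <= N by rewrite ler1n.
have N0 : 0 < N by exact: lt_le_trans N1.
have lnN0 : 0 <= ln N by exact: ln_ge0.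
have mt := measurable_trunc N.
have mqE : measurable_fun setT (fun x => (q x)%:E) by exact/measurable_EFinP.
have mtE : measurable_fun setT (fun x => (tr N (q x))%:E) by exact/measurable_EFinP.
have q0E x : (0 <= (q x)%:E)%E by rewrite lee_fin.
have mlt : measurable_fun setT (fun x => ((ln (tr N (q x)) + ln N) * q x)%:E).
  apply/measurable_EFinP; apply: measurable_funM => //; apply: measurable_funD => //.
  exact: (measurableT_comp (@measurable_ln R) mt).
have lt0 x : 0 <= ln (tr N (q x)) + ln N.
  rewrite -lnM ?posrE ?trunc_gt0// ln_ge0// -ler_pdivrMr// mul1r.
  by have /andP[] := trunc_itv (q x) N1.
have ltq0 x : (0 <= ((ln (tr N (q x)) + ln N) * q x)%:E)%E.
  by rewrite lee_fin mulr_ge0.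
have It : (\int[P]_x (expR (ln (tr N (q x)) + ln N))%:E <= (N + 1)%:E)%E.
  apply: (@le_trans _ _ (\int[P]_x (N%:E * (q x)%:E + 1%:E))%E); last first.
    rewrite ge0_integralD//; last 2 first.
    - by move=> x _; rewrite mule_ge0// lee_fin ltW.
    - exact: measurable_funeM.
    rewrite ge0_integralZl ?lee_fin ?(ltW N0)// q1 mule1.
    by rewrite probability_integral_cst -EFinD.
  apply: ge0_le_integral => //.
  - apply/measurable_EFinP; apply: measurableT_comp => //.
    by apply: measurable_funD => //; exact: (measurableT_comp (@measurable_ln R) mt).
  - by apply: emeasurable_funD => //; exact: measurable_funeM.
  move=> x _; rewrite -EFinM -EFinD lee_fin expRD !lnK ?posrE ?trunc_gt0// mulrC.
  have : tr N (q x) <= q x + N^-1.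
    by rewrite /tr ge_min ge_max lerDl lerDr q0 invr_ge0 ltW.
  by move=> /(ler_wpM2l (ltW N0)); rewrite mulrDr mulfV ?gt_eqF.
have lnI : ln (fine (\int[P]_x (expR (ln (tr N (q x)) + ln N))%:E)) <= ln N + N^-1.
  have fin : (\int[P]_x (expR (ln (tr N (q x)) + ln N))%:E)%E \is a fin_num.
    rewrite ge0_fin_numE ?(le_lt_trans It) ?ltry//.
    by apply: integral_ge0 => x _; rewrite lee_fin expR_ge0.
  set J := fine _.
  have JN : J <= N + 1 by rewrite -lee_fin /J fineK.
  have [J0|J0] := leP J 0.
    by rewrite (le_trans (ln_le0 (le_trans J0 ler01)))// addr_ge0// invr_ge0 ltW.
  apply: (@le_trans _ _ (ln (N * (1 + N^-1)))).
    rewrite ler_ln ?posrE// ?mulr_gt0// ?addr_gt0 ?invr_gt0//.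
    by rewrite mulrDr mulr1 mulfV ?gt_eqF.
  rewrite lnM ?posrE ?addr_gt0 ?invr_gt0// lerD2l le_ln1Dx//.
  by rewrite (lt_trans (ltrN10 R))// invr_gt0.
(* With ln N written as the integral of q ln N and added to both sides, only nonnegative functions
   are integrated. *)
have key : (\int[P]_x (H n x)%:E + (ln N)%:E <= (W + 1 + N^-1)%:E + (ln N)%:E)%E.
  have -> : ((ln N)%:E = \int[P]_x ((ln N)%:E * (q x)%:E))%E.
    by rewrite ge0_integralZl ?lee_fin// q1 mule1.
  rewrite -ge0_integralD//; last 4 first.
  - by move=> x _; rewrite lee_fin; exact: H0.
  - by apply/measurable_EFinP; exact: mH.
  - by move=> x _; rewrite mule_ge0 ?lee_fin.
  - exact: measurable_funeM.
  apply: (@le_trans _ _ (\int[P]_x (((ln (tr N (q x)) + ln N) * q x)%:E + 1%:E))%E).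
    apply: ge0_le_integral.
    - exact: measurableT.
    - by move=> x _; rewrite adde_ge0 ?mule_ge0 ?lee_fin//; exact: H0.
    - apply: emeasurable_funD; first by apply/measurable_EFinP; exact: mH.
      exact: measurable_funeM.
    - exact: emeasurable_funD.
    move=> x _; rewrite -EFinM -!EFinD lee_fin /H -/N.
    have : q x * ln (Num.min (q x) N) <= q x * ln (tr N (q x)).
      have [->|qn0] := eqVneq (q x) 0; first by rewrite !mul0r.
      have qp : 0 < q x by rewrite lt_def qn0 q0.
      rewrite ler_pM2l// ler_ln ?posrE ?trunc_gt0// ?lt_min ?qp//.
      by rewrite /tr le_min !ge_min le_max lexx/= lexx orbT.
    by move=> h; rewrite mulrDl addrAC lerD2r lerD2r [leRHS]mulrC.
  rewrite ge0_integralD// probability_integral_cst.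
  rewrite ge0_integralZl ?lee_fin// q1 mule1.
  apply: (le_trans (leeD2r _ (trW n))); rewrite -!EFinD lee_fin.
  by rewrite -[leLHS]addrA [leLHS]addrC -[leRHS]addrA lerD2l [leRHS]addrC.
by move: key; rewrite leeD2rE.
Qed.

(** Monotone limit of [entropy_trunc_le] in n, after which the added 1 is subtracted; the finite
    bound just obtained supplies the integrability this requires. *)
Lemma entropy_le : (\int[P]_x (q x * ln (q x))%:E <= W%:E)%E.
Proof.
pose L x := q x * ln (q x) + 1.
have mL : measurable_fun setT L.
  apply: measurable_funD => //; apply: measurable_funM => //.
  exact: (measurableT_comp (@measurable_ln R) mq).
have L0 x : 0 <= L x.
  have := @entropy_trunc_ge0 (Num.max 1 (q x)) (q x).
  by rewrite min_l ?le_max ?lexx ?orbT//; apply.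
(* Pointwise the sequence is eventually constant, as soon as n + 1 exceeds q x. *)
have HL x : (H n x)%:E @[n --> \oo] --> (L x)%:E.
  apply: cvg_near_cst; exists (Num.truncn (q x)) => // n /= hn.
  rewrite /H min_l// ltW// (lt_le_trans (truncnS_gt _))// ler_nat ltnS//.
have cvgH : (\int[P]_x (H n x)%:E)%E @[n --> \oo] --> (\int[P]_x (L x)%:E)%E.
  rewrite (eq_integral (fun x => limn (fun n => (H n x)%:E))).
    apply: (@cvg_monotone_convergence _ _ _ P setT measurableT
      (fun n x => (H n x)%:E)).
    - by move=> n; apply/measurable_EFinP; exact: mH.
    - by move=> n x _; rewrite lee_fin; exact: H0.
    move=> x _ a b ab; rewrite lee_fin /H lerD2r.
    have [->|qn0] := eqVneq (q x) 0; first by rewrite !mul0r.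
    have qp : 0 < q x by rewrite lt_def qn0 q0.
    rewrite ler_pM2l// ler_ln ?posrE ?lt_min ?qp ?ltr0n//.
    by rewrite le_min !ge_min lexx/= ler_nat ltnS ab orbT.
  by move=> x _; apply/esym/cvg_lim.
have LW : (\int[P]_x (L x)%:E <= (W + 1)%:E)%E.
  apply/lee_addgt0Pr => e e0; rewrite -(cvg_lim _ cvgH)//.
  apply: lime_le; first by apply/cvg_ex; eexists; exact: cvgH.
  exists (Num.truncn e^-1) => // n /= hn.
  apply: (le_trans (entropy_trunc_le n)); rewrite -EFinD lee_fin lerD2l.
  rewrite -[leRHS]invrK lef_pV2 ?posrE ?invr_gt0//.
  by rewrite ltW// (lt_le_trans (truncnS_gt _))// ler_nat ltnS.
have iL : P.-integrable setT (EFin \o L).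
  apply/integrableP; split; first exact/measurable_EFinP.
  rewrite (eq_integral (fun x => (L x)%:E)); first exact: le_lt_trans LW (ltry _).
  by move=> x _; rewrite /= ger0_norm.
have i1 : P.-integrable setT (EFin \o cst (1 : R)).
  exact: finite_measure_integrable_cst.
rewrite (eq_integral (fun x => ((L x)%:E - 1%:E)%E)); last first.
  by move=> x _; rewrite -EFinB /L addrK.
rewrite (@integralB_EFin _ _ _ P setT L (cst 1))//.
rewrite probability_integral_cst leeBlDr//.
Qed.

End Entropy.

(** * The normalising constant, and pi as an integral against Lebesgue measure *)

Section Normalization.
Variables (R : realType) (d : nat) (eta : R) (f g : d.-tuple R -> R).
Local Notation T := (d.-tuple R).
Local Notation m := (lebRd R d).
Hypotheses (cf : convex_fun f) (cg : convex_fun g).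

Lemma lebRd_int2E (w : T * T -> \bar R) : measurable_fun setT w ->
  (forall p, 0 <= w p)%E ->
  lebRd_int (fun x => lebRd_int (fun y => w (x, y))) =
  (\int[m]_x \int[m]_y w (x, y))%E.
Proof.
move=> mw w0.
have E x : lebRd_int (fun y => w (x, y)) = (\int[m]_y w (x, y))%E.
  by apply: lebRd_intE => [|y]; [exact: (measurableT_comp mw (pair1_measurable x))|exact: w0].
rewrite (_ : (fun x => _) = fun x => \int[m]_y w (x, y))%E; last by apply/funext.
apply: lebRd_intE; first exact: measurable_fun_fubini_tonelli_F.
by move=> x; apply: integral_ge0 => y _; exact: w0.
Qed.

Variable pi : probability (T * T)%type R.
Variable Z : \bar R.
Hypothesis ZE :
  Z = lebRd_int (fun x => lebRd_int (fun y => (joint_dens f g eta x y)%:E)).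
Hypothesis piZ : forall A, measurable A ->
  pi A = (lebRd_int (fun x => lebRd_int (fun y =>
            (\1_A (x, y))%:E * (joint_dens f g eta x y)%:E)) * (fine Z)^-1%:E)%E.

(** If [fine Z] were 0, its inverse would be 0 as well and pi would have total mass 0 instead of
    1. *)
Lemma fine_Z_gt0 : 0 < fine Z.
Proof.
rewrite lt_def; apply/andP; split.
  apply/eqP => Z0.
  have : pi setT = 1%E by exact: probability_setT.
  rewrite piZ// Z0 invr0 mule0 => /esym/eqP.
  by rewrite onee_eq0.
apply: fine_ge0; rewrite ZE.
rewrite (lebRd_int2E (w := fun p => (joint_dens f g eta p.1 p.2)%:E)).
- apply: integral_ge0 => x _; apply: integral_ge0 => y _.
  by rewrite lee_fin joint_dens_ge0.
- by apply/measurable_EFinP; exact: measurable_joint.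
- by move=> p; rewrite lee_fin joint_dens_ge0.
Qed.

Lemma pi_densE A : measurable A -> pi A =
  (\int[m]_x \int[m]_y (\1_A (x, y) * (joint_dens f g eta x y / fine Z))%:E)%E.
Proof.
move=> mA; rewrite piZ//.
pose w (p : T * T) := ((\1_A p)%:E * (joint_dens f g eta p.1 p.2)%:E)%E.
have mw : measurable_fun setT w.
  apply: emeasurable_funM; first exact/measurable_EFinP/measurable_indic.
  by apply/measurable_EFinP; exact: measurable_joint.
have w0 p : (0 <= w p)%E by rewrite mule_ge0// lee_fin// joint_dens_ge0.
have ZV : (0 <= (fine Z)^-1%:E)%E by rewrite lee_fin invr_ge0 ltW// fine_Z_gt0.
have mW : measurable_fun setT (fun x => \int[m]_y w (x, y))%E.
  exact: measurable_fun_fubini_tonelli_F.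
have W0 x : (0 <= \int[m]_y w (x, y))%E.
  by apply: integral_ge0 => y _; exact: w0.
rewrite (lebRd_int2E mw w0).
apply: (etrans (esym (@ge0_integralZr _ _ _ m setT measurableT _ mW _
  (fun x _ => W0 x) ZV))).
apply: eq_integral => x _.
have mwx : measurable_fun setT (fun y => w (x, y)).
  exact: (measurableT_comp mw (pair1_measurable x)).
apply: (etrans (esym (@ge0_integralZr _ _ _ m setT measurableT _ mwx _
  (fun y _ => w0 (x, y)) ZV))).
by apply: eq_integral => y _; rewrite /w -!EFinM mulrA.
Qed.

End Normalization.

(** * The entropy bound for one coupling, then the infimum over couplings *)

Lemma KL_coupling_le (R : realType) (d : nat) (eta : R) (f g : d.-tuple R -> R)
    (z0 : R) (pi : probability (d.-tuple R * d.-tuple R)%type R)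
    (nu : nat -> probability (d.-tuple R) R)
    (mu : nat -> probability (d.-tuple R * d.-tuple R)%type R)
    (gam : probability (d.-tuple R * d.-tuple R)%type R) (k : nat) :
  0 < eta -> convex_fun f -> convex_fun g -> 0 < z0 ->
  (forall A, measurable A -> pi A = (\int[lebRd R d]_x \int[lebRd R d]_y
    (\1_A (x, y) * (joint_dens f g eta x y / z0))%:E)%E) ->
  (forall k A, measurable A ->
    mu k A = (\int[nu k]_x cond_int g eta x (fun y => (\1_A (x, y))%:E))%E) ->
  (forall k B, measurable B ->
    nu k.+1 B = (\int[mu k]_p cond_int f eta p.2 (fun x => (\1_B x)%:E))%E) ->
  is_coupling (nu 0%N) (marginalX pi) gam ->
  (KL (mu k.+1) pi <=
   \int[gam]_p (dist2 p.1 p.2)%:E * ((k.+1%:R * eta)^-1)%:E)%E.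
Proof.
move=> eta0 cf cg z00 piE muE nuE cpl.
set I := (\int[gam]_p _)%E.
have I0 : (0 <= I)%E.
  by apply: integral_ge0 => p _; rewrite lee_fin dist2_ge0.
have K0 : 0 < k.+1%:R :> R by rewrite ltr0n.
have ke0 : 0 < (k.+1%:R * eta)^-1 by rewrite invr_gt0 mulr_gt0.
(* A coupling of infinite cost gives nothing to prove; otherwise the cost is a real number, as the
   constant W of the entropy section must be. *)
have [Ioo|] := eqVneq I +oo%E.
  by rewrite Ioo mulyr gtr0_sg// mul1e leey.
move=> Ifin; have IE : I = (fine I)%:E by rewrite fineK// ge0_fin_numE// ltey.
pose q := pidens eta f g z0 mu k.
pose c := (2 * eta * (k.+1).*2%:R)^-1.
have dens := is_density_pidens eta0 cf cg z00 piE muE nuE k.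
have nuq := integral_nuS_pidens eta0 cf cg z00 piE muE nuE k.
have [mqp q0p _] := dens.
have mq : measurable_fun setT q by exact: measurable_pidens.
have q0 x : 0 <= q x by exact: pidens_ge0.
have Iq : (\int[pi]_p (q p.1)%:E = 1)%E.
  rewrite -(probability_integral_cst (nu k.+1) 1).
  rewrite (nuq (cst 1))//.
  by apply: eq_integral => p _; rewrite mul1r.
(* Here the constant 1 / (4 eta (k + 1)) is relaxed to 1 / (eta (k + 1)). *)
apply: (@le_trans _ _ (c * fine I)%:E); last first.
  have fI0 : 0 <= fine I by exact: fine_ge0.
  rewrite [X in (_ <= X * _)%E]IE -EFinM lee_fin mulrC; apply: ler_wpM2l => //.
  rewrite /c lef_pV2 ?posrE ?mulr_gt0 ?ltr0n//.
  by rewrite -muln2 natrM; nra.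
(* [KL] is an infimum over densities, so exhibiting one density is enough for an upper bound. *)
apply: (@le_trans _ _ (\int[pi]_p (q p.1 * ln (q p.1))%:E)%E).
  by apply: ereal_inf_lbound; exists (fun p => q p.1).
apply: entropy_le => //.
move=> n; pose N : R := n.+1%:R; cbv zeta; rewrite -/N.
have N1 : 1 <= N by rewrite ler1n.
have N0 : 0 < N by rewrite ltr0n.
pose u x := ln (Num.min (Num.max (q x) N^-1) N) + ln N.
have bu : bm u 0 (ln N + ln N).
  split.
    apply: measurable_funD => //; apply: (measurableT_comp (@measurable_ln R)).
    exact: measurable_trunc.
  move=> x; have /andP[t1 t2] := trunc_itv (q x) N1.
  have t0 := trunc_gt0 (q x) N0.
  rewrite /u lerD2r ler_ln ?posrE// t2 andbT.
  by rewrite -lerBlDr sub0r -lnV ?posrE// ler_ln ?posrE ?invr_gt0.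
have := transport_bound eta0 cf cg z00 piE muE nuE k cpl bu.
rewrite -/c -/I [X in (_ <= _ + _ * X)%E]IE -EFinM -EFinD; apply: le_trans.
have [mu' ub] := bu.
rewrite (nuq u mu')//.
by move=> x; have /andP[] := ub x.
Qed.

Theorem mainTheorem5 (R : realType) (d : nat) (eta : R) (f g : d.-tuple R -> R)
  (Z : \bar R)
  (pi : probability (d.-tuple R * d.-tuple R)%type R)
  (mu0 : probability (d.-tuple R) R)
  (nu : nat -> probability (d.-tuple R) R)
  (mu : nat -> probability (d.-tuple R * d.-tuple R)%type R) :
  0 < eta ->
  convex_fun f -> convex_fun g ->
  (* normalising constant of pi^{XY} *)
  Z = lebRd_int (fun x => lebRd_int (fun y => (joint_dens f g eta x y)%:E)) ->
  (Z < +oo)%E ->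
  (* pi^{XY} has density joint_dens / Z w.r.t. Lebesgue measure on R^d x R^d *)
  (forall A, measurable A ->
     pi A = (lebRd_int (fun x => lebRd_int (fun y =>
               (\1_A (x, y))%:E * (joint_dens f g eta x y)%:E)) * (fine Z)^-1%:E)%E) ->
  (* pi^{XY} has finite second moments *)
  (\int[pi]_p (sqnorm p.1 + sqnorm p.2)%:E < +oo)%E ->
  (* mu0 = law of x^0 has finite second moment *)
  (\int[mu0]_x (sqnorm x)%:E < +oo)%E ->
  (* Gibbs sampler: nu k = law of x^k, mu k = law of (x^k, y^k) *)
  (forall A, measurable A -> nu 0%N A = mu0 A) ->
  (forall k A, measurable A ->
     mu k A = (\int[nu k]_x cond_int g eta x (fun y => (\1_A (x, y))%:E))%E) ->
  (forall k B, measurable B ->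
     nu k.+1 B = (\int[mu k]_p cond_int f eta p.2 (fun x => (\1_B x)%:E))%E) ->
  forall k : nat, (1 <= k)%N ->
    (KL (mu k) pi <= W2sq mu0 (marginalX pi) * ((k%:R * eta)^-1)%:E)%E.
Proof.
move=> eta0 cf cg ZE _ piZ _ _ nu0 muE nuE [//|k] _.
have z00 := fine_Z_gt0 cf cg ZE piZ.
have piE := pi_densE cf cg ZE piZ.
have ke0 : 0 < k.+1%:R * eta by rewrite mulr_gt0 ?ltr0n.
(* The factor k eta is moved to the left so that the infimum stands alone and can be bounded
   coupling by coupling; then it is moved back. *)
rewrite lee_pdivlMr//; apply: le_ereal_inf_tmp => _ [gam cpl <-].
rewrite -lee_pdivlMr//.
apply: (KL_coupling_le k eta0 cf cg z00 piE muE nuE) => A mA.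
by rewrite nu0//; exact: cpl.
Qed.
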